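(* Let $(\mathcal A,\mathcal B,\mathcal C)$ be a recollement of extriangulated categories with functors $i_*:\mathcal A\to\mathcal B$, $i^*,i^!:\mathcal B\to\mathcal A$, $j^*:\mathcal B\to\mathcal C$, $j_!,j_*:\mathcal C\to\mathcal B$, and let $(\mathcal X,\mathcal Y)$ be a cotorsion pair in $\mathcal B$. If $i_*i^!(\mathcal X)\subseteq\mathcal X$, $i_*i^*(\mathcal X)\subseteq\mathcal X$, $i_*i^*(\mathcal Y)\subseteq\mathcal Y$, $j_*j^*(\mathcal X)\subseteq\mathcal X$, $j_*j^*(\mathcal Y)\subseteq\mathcal Y$, $j_!j^*(\mathcal Y)\subseteq\mathcal Y$, and if $i^*$ and $i^!$ are exact, then the abelian category $\underline{\mathcal H}$ admits a recollement relative to the abelian categories $\underline{\mathcal H'}$ and $\underline{\mathcal H''}$, given by the induced functors $$\underline{i_*}:\underline{\mathcal H'}\to\underline{\mathcal H},\quad \underline{i^*},\underline{i^!}:\underline{\mathcal H}\to\underline{\mathcal H'},\quad \underline{j^*}:\underline{\mathcal H}\to\underline{\mathcal H''},\quad \underline{j_!},\underline{j_*}:\underline{\mathcal H''}\to\underline{\mathcal H},$$ where $\underline{\mathcal H}$, $\underline{\mathcal H'}$, $\underline{\mathcal H''}$ are the hearts of the cotorsion pairs $(\mathcal X,\mathcal Y)$, $(i^*(\mathcal X),i^!(\mathcal Y))$ and $(j^*(\mathcal X),j^*(\mathcal Y))$ in $\mathcal B$, $\mathcal A$, $\mathcal C$, respectively.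
   Context: Extriangulated categories (Nakaoka–Palu). An extriangulated category is a triple $(\mathcal C,\mathbb E,\mathfrak s)$ with $\mathcal C$ additive and $\mathbb E:\mathcal C^{op}\times\mathcal C\to\mathrm{Ab}$ an additive bifunctor. For $\delta\in\mathbb E(C,A)$, $a:A\to A'$, $c:C'\to C$ write $a_*\delta=\mathbb E(C,a)(\delta)$, $c^*\delta=\mathbb E(c,A)(\delta)$; a morphism from $\delta\in\mathbb E(C,A)$ to $\delta'\in\mathbb E(C',A')$ is a pair $(a:A\to A',c:C\to C')$ with $a_*\delta=c^*\delta'$. Sequences $A\to B\to C$ and $A\to B'\to C$ are equivalent if there is an isomorphism $B\to B'$ compatible with the identities of $A$ and $C$. $\mathfrak s$ assigns to each $\delta\in\mathbb E(C,A)$ an equivalence class $\mathfrak s(\delta)=[A\to B\to C]$ so that every morphism $(a,c)$ of extensions lifts to a morphism $(a,b,c)$ of realizing sequences, $\mathfrak s(0)=[A\to A\oplus C\to C]$ and $\mathfrak s(\delta\oplus\delta')=\mathfrak s(\delta)\oplus\mathfrak s(\delta')$. Axioms: (ET3) if $A\xrightarrow{x}B\xrightarrow{y}C$, $A'\xrightarrow{x'}B'\xrightarrow{y'}C'$ realize $\delta,\delta'$ and $bx=x'a$, there is $c$ with $cy=y'b$ and $(a,c):\delta\to\delta'$ a morphism; (ET4) if $A\xrightarrow{f}B\xrightarrow{f'}D$ realizes $\delta$ and $B\xrightarrow{g}C\xrightarrow{g'}F$ realizes $\delta'$, there are an object $E$, $\delta''\in\mathbb E(E,A)$ realized by $A\xrightarrow{gf}C\xrightarrow{h'}E$,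 and $d:D\to E$, $e:E\to F$ with $df'=h'g$, $eh'=g'$, such that $D\xrightarrow{d}E\xrightarrow{e}F$ realizes $f'_*\delta'$, $d^*\delta''=\delta$, $f_*\delta''=e^*\delta'$; and the duals (ET3)$^{op}$, (ET4)$^{op}$. If $A\xrightarrow{x}B\xrightarrow{y}C$ realizes some $\delta$, it is an $\mathbb E$-triangle ($A\to B\to C\dashrightarrow$), $x$ is an inflation and $y$ a deflation. Standing assumptions. Every extriangulated category satisfies (WIC): for composable $f,g$, if $gf$ is an inflation then $f$ is an inflation, and if $gf$ is a deflation then $g$ is a deflation. Every extriangulated category has enough projectives and enough injectives: $P$ is projective if every morphism $P\to C$ lifts through every deflation $B\to C$; enough projectives means every $M$ is in an $\mathbb E$-triangle $A\to P\to M\dashrightarrow$ with $P$ projective; injectives dually. All subcategories are full, additive and closed under isomorphisms; for a functor $F$, $F(\mathcal X)$ denotes the class of objects isomorphic to some $F(X)$, $X\in\mathcal X$. Cotorsion pairs and hearts. A pair $(\mathcal X,\mathcal Y)$ of subcategories of $\mathcal C$, closed under direct summands, is a cotorsion pair in $\mathcal C$ if (CP1) $\mathbb E(X,Y)=0$ for all $X\in\mathcal X$, $Y\in\mathcal Y$, and (CP2) for every $C\in\mathcal C$ there are $\mathbb E$-triangles $Y^1\to X^1\to C\dashrightarrow$ and $C\to Y_1\to X_1\dashrightarrow$ with $X^1,X_1\in\mathcal X$, $Y^1,Y_1\in\mathcal Y$. For such a pair, $\mathcal C^+$ is the class of objects $C$ admitting an $\mathbb E$-triangle $Y\to W\to C\dashrightarrow$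 with $Y\in\mathcal Y$, $W\in\mathcal X\cap\mathcal Y$, and $\mathcal C^-$ is the class of objects $C$ admitting an $\mathbb E$-triangle $C\to W\to X\dashrightarrow$ with $W\in\mathcal X\cap\mathcal Y$, $X\in\mathcal X$. The heart of $(\mathcal X,\mathcal Y)$ is the additive quotient category $(\mathcal C^+\cap\mathcal C^-)/(\mathcal X\cap\mathcal Y)$, with the objects of $\mathcal C^+\cap\mathcal C^-$ and with morphisms taken modulo those factoring through an object of $\mathcal X\cap\mathcal Y$; it is an abelian category (Liu–Nakaoka). Under the hypotheses of the claim, $(i^*(\mathcal X),i^!(\mathcal Y))$ and $(j^*(\mathcal X),j^*(\mathcal Y))$ are cotorsion pairs in $\mathcal A$ and $\mathcal C$. For a functor $F$ among $i^*,i_*,i^!,j_!,j^*,j_*$, the underlined functor $\underline F$ is the one obtained by restricting $F$ to the intersections $(-)^+\cap(-)^-$ attached to the relevant cotorsion pairs and passing to the quotients; part of the claim is that this is well defined. Exactness (Wang–Wei–Zhang). A morphism is compatible if, whenever it is both an inflation and a deflation, it is an isomorphism. A sequence $A\xrightarrow{f}B\xrightarrow{g}C$ is right exact if there are an $\mathbb E$-triangle $K\xrightarrow{h_2}B\xrightarrow{g}C\dashrightarrow$ and a compatible deflation $h_1:A\to K$ with $f=h_2h_1$; it is left exact if there are an $\mathbb E$-triangle $A\xrightarrow{f}B\xrightarrow{h_2}K\dashrightarrow$ and a compatible inflation $h_1:K\to C$ with $g=h_1h_2$. A four-term $\mathbb E$-triangle sequence $A\xrightarrow{f}B\xrightarrow{g}C\xrightarrow{h}D$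 is right exact (resp. left exact) if there are $\mathbb E$-triangles $A\xrightarrow{f}B\xrightarrow{g_1}K\dashrightarrow$ and $K\xrightarrow{g_2}C\xrightarrow{h}D\dashrightarrow$ with $g=g_2g_1$ and $g_1$ (resp. $g_2$) compatible. An additive functor $F$ between extriangulated categories is right exact if it preserves compatible morphisms, sends right exact sequences to right exact sequences (so for each $\mathbb E$-triangle $A\xrightarrow{f}B\xrightarrow{g}C\overset{\delta}\dashrightarrow$ there are an $\mathbb E$-triangle $A'\xrightarrow{x}FB\xrightarrow{Fg}FC\dashrightarrow$ and a compatible deflation $y:FA\to A'$ with $Ff=xy$), and the latter $\mathbb E$-triangles are realizations of $\eta(\delta)\in\mathbb E(FC,A')$ for a natural transformation $\eta$; left exact functors are defined dually. $F$ is exact if it preserves compatible morphisms and there is a natural transformation $\eta:\mathbb E(-,-)\Rightarrow\mathbb E(F-,F-)$ with $\mathfrak s(\eta(\delta))=[FA\to FB\to FC]$ whenever $\mathfrak s(\delta)=[A\to B\to C]$. Recollement. A recollement $(\mathcal A,\mathcal B,\mathcal C)$ of extriangulated categories consists of exact functors $i_*:\mathcal A\to\mathcal B$, $j^*:\mathcal B\to\mathcal C$, right exact functors $i^*:\mathcal B\to\mathcal A$, $j_!:\mathcal C\to\mathcal B$ and left exact functors $i^!:\mathcal B\to\mathcal A$, $j_*:\mathcal C\to\mathcal B$ such that: (R1) $(i^*,i_*,i^!)$ and $(j_!,j^*,j_* )$ are adjoint triples; (R2) $\operatorname{Im}i_*=\operatorname{Ker}j^*$; (R3) $i_*,j_!,j_*$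 are fully faithful; (R4) for each $B\in\mathcal B$ there is a left exact $\mathbb E$-triangle sequence $i_*i^!(B)\to B\to j_*j^*(B)\to i_*(A)$ with $A\in\mathcal A$, the first two maps being adjunction morphisms; (R5) for each $B\in\mathcal B$ there is a right exact $\mathbb E$-triangle sequence $i_*(A')\to j_!j^*(B)\to B\to i_*i^*(B)$ with $A'\in\mathcal A$, the last two maps being adjunction morphisms. For abelian categories, a recollement (of the middle category relative to the two outer ones) is given by additive functors satisfying (R1), (R2) with $\operatorname{Im}$ the essential image, and (R3). *)

(* Defs.v *)
From HB Require Import structures.
From mathcomp Require Import all_boot all_algebra.
From mathcomp Require Import boolp.

Set Implicit Arguments.
Unset Strict Implicit.
Unset Printing Implicit Defensive.

Import GRing.Theory.
Local Open Scope ring_scope.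
Local Open Scope quotient_scope.

Record preaddCat := PreaddCat {
  obj :> Type;
  hom : obj -> obj -> zmodType;
  idm : forall A, hom A A;
  comp : forall A B C, hom B C -> hom A B -> hom A C;
  comp1m : forall A B (f : hom A B), comp (idm B) f = f;
  compm1 : forall A B (f : hom A B), comp f (idm A) = f;
  compA : forall A B C D (h : hom C D) (g : hom B C) (f : hom A B),
    comp h (comp g f) = comp (comp h g) f;
  compDl : forall A B C (g g' : hom B C) (f : hom A B),
    comp (g + g') f = comp g f + comp g' f;
  compDr : forall A B C (g : hom B C) (f f' : hom A B),
    comp g (f + f') = comp g f + comp g f'
}.

Arguments idm {p} A.

Notation "g \co f" := (comp g f) (at level 40, left associativity).

Definition is_iso (C : preaddCat) (A B : C) (f : hom A B) : Prop :=
  exists g : hom B A, g \co f = idm A /\ f \co g = idm B.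

Definition isomorphic (C : preaddCat) (A B : C) : Prop :=
  exists f : hom A B, is_iso f.

Definition is_zero (C : preaddCat) (Z : C) : Prop := idm Z = 0.

Record biproduct (C : preaddCat) (A B : C) := Biproduct {
  bp :> C;
  in1 : hom A bp;
  in2 : hom B bp;
  pr1 : hom bp A;
  pr2 : hom bp B;
  pr1_in1 : pr1 \co in1 = idm A;
  pr2_in2 : pr2 \co in2 = idm B;
  pr1_in2 : pr1 \co in2 = 0;
  pr2_in1 : pr2 \co in1 = 0;
  bp_sum : in1 \co pr1 + in2 \co pr2 = idm bp
}.

Definition is_additive (C : preaddCat) : Prop :=
  (exists Z : C, is_zero Z) /\ (forall A B : C, inhabited (biproduct A B)).

Definition bimap (C : preaddCat) (A B A' B' : C) (P : biproduct A A')
    (Q : biproduct B B') (f : hom A B) (f' : hom A' B') : hom P Q :=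
  in1 Q \co f \co pr1 P + in2 Q \co f' \co pr2 P.

Definition is_mono (C : preaddCat) (A B : C) (f : hom A B) : Prop :=
  forall (Z : C) (g h : hom Z A), f \co g = f \co h -> g = h.

Definition is_epi (C : preaddCat) (A B : C) (f : hom A B) : Prop :=
  forall (Z : C) (g h : hom B Z), g \co f = h \co f -> g = h.

Definition is_kernel (C : preaddCat) (K A B : C) (k : hom K A) (f : hom A B)
    : Prop :=
  f \co k = 0 /\
  forall (Z : C) (g : hom Z A), f \co g = 0 -> exists! u : hom Z K, k \co u = g.

Definition is_cokernel (C : preaddCat) (A B K : C) (f : hom A B) (k : hom B K)
    : Prop :=
  k \co f = 0 /\
  forall (Z : C) (g : hom B Z), g \co f = 0 -> exists! u : hom K Z, u \co k = g.

Record is_abelian (C : preaddCat) : Prop := IsAbelian {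
  abelian_additive : is_additive C;
  abelian_ker : forall (A B : C) (f : hom A B),
    exists (K : C) (k : hom K A), is_kernel k f;
  abelian_coker : forall (A B : C) (f : hom A B),
    exists (K : C) (k : hom B K), is_cokernel f k;
  abelian_mono : forall (A B : C) (f : hom A B), is_mono f ->
    exists (D : C) (g : hom B D), is_kernel f g;
  abelian_epi : forall (A B : C) (f : hom A B), is_epi f ->
    exists (D : C) (g : hom D A), is_cokernel g f
}.

Record functor (C D : preaddCat) := Functor {
  fobj :> C -> D;
  fmor : forall A B : C, hom A B -> hom (fobj A) (fobj B);
  fmor1 : forall A : C, fmor (idm A) = idm (fobj A);
  fmorM : forall (A B E : C) (g : hom B E) (f : hom A B),
    fmor (g \co f) = fmor g \co fmor f;
  fmorD : forall (A B : C) (f g : hom A B), fmor (f + g) = fmor f + fmor g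
}.

Record adjunction (C D : preaddCat) (F : functor C D) (G : functor D C) :=
  Adjunction {
    adj_unit : forall A : C, hom A (G (F A));
    adj_counit : forall B : D, hom (F (G B)) B;
    unit_nat : forall (A A' : C) (f : hom A A'),
      adj_unit A' \co f = fmor G (fmor F f) \co adj_unit A;
    counit_nat : forall (B B' : D) (f : hom B B'),
      adj_counit B' \co fmor F (fmor G f) = f \co adj_counit B;
    counit_unit : forall A : C, adj_counit (F A) \co fmor F (adj_unit A) = idm (F A);
    unit_counit : forall B : D, fmor G (adj_counit B) \co adj_unit (G B) = idm (G B)
  }.

Definition fully_faithful (C D : preaddCat) (F : functor C D) : Prop :=
  forall A B : C, bijective (@fmor C D F A B).

(* [ess_im F X] is the class denoted F(X) : all objects isomorphic to some
   F M with M in X. *)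
Definition ess_im (C D : preaddCat) (F : functor C D) (X : C -> Prop)
    : D -> Prop :=
  fun N => exists2 M : C, X M & isomorphic N (F M).

Definition subclass (T : Type) (X Y : T -> Prop) : Prop := forall M, X M -> Y M.

Definition image_is_kernel (A B C : preaddCat) (F : functor A B)
    (G : functor B C) : Prop :=
  forall M : B, ess_im F (fun=> True) M <-> is_zero (G M).

Record abelian_recollement (A B C : preaddCat)
    (i_low : functor A B) (i_up i_shr : functor B A)
    (j_up : functor B C) (j_shr j_low : functor C B) : Prop :=
  AbelianRecollement {
    abrec_left : is_abelian A;
    abrec_middle : is_abelian B;
    abrec_right : is_abelian C;
    abrec_adj_iup_ilow : inhabited (adjunction i_up i_low);
    abrec_adj_ilow_ishr : inhabited (adjunction i_low i_shr);
    abrec_adj_jshr_jup : inhabited (adjunction j_shr j_up);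
    abrec_adj_jup_jlow : inhabited (adjunction j_up j_low);
    abrec_im_ker : image_is_kernel i_low j_up;
    abrec_ff_ilow : fully_faithful i_low;
    abrec_ff_jshr : fully_faithful j_shr;
    abrec_ff_jlow : fully_faithful j_low
  }.

Section CompositionLemmas.

Variable C : preaddCat.

Lemma comp0m (A B D : C) (f : hom A B) : (0 : hom B D) \co f = 0.
Proof. by apply: (@addrI _ ((0 : hom B D) \co f)); rewrite -compDl !addr0. Qed.

Lemma compm0 (A B D : C) (f : hom B D) : f \co (0 : hom A B) = 0.
Proof. by apply: (@addrI _ (f \co (0 : hom A B))); rewrite -compDr !addr0. Qed.

Lemma compNm (A B D : C) (g : hom B D) (f : hom A B) :
  (- g) \co f = - (g \co f).
Proof. by apply/eqP; rewrite -addr_eq0 -compDl addNr comp0m. Qed.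

Lemma compmN (A B D : C) (g : hom B D) (f : hom A B) :
  g \co (- f) = - (g \co f).
Proof. by apply/eqP; rewrite -addr_eq0 -compDr addNr compm0. Qed.

End CompositionLemmas.

(* The object class of a full additive subcategory closed under isomorphisms. *)
Record is_subcat (C : preaddCat) (X : C -> Prop) : Prop := IsSubcat {
  subcat_iso : forall A B : C, isomorphic A B -> X A -> X B;
  subcat_zero : exists2 Z : C, is_zero Z & X Z;
  subcat_sum : forall (A B : C) (P : biproduct A B), X A -> X B -> X P
}.

Definition summand_closed (C : preaddCat) (X : C -> Prop) : Prop :=
  forall (A B : C) (P : biproduct A B), X P -> X A /\ X B.

Definition inter (T : Type) (X Y : T -> Prop) : T -> Prop :=
  fun M => X M /\ Y M.

Lemma inter_subcat (C : preaddCat) (X Y : C -> Prop) :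
  is_subcat X -> is_subcat Y -> is_subcat (inter X Y).
Proof.
move=> [Xi [Z Z0 XZ] Xs] [Yi [Z' Z0' YZ] Ys]; split.
- by move=> A B iAB [XA YA]; split; [apply: Xi XA | apply: Yi YA].
- exists Z => //; split => //; apply: Yi YZ; exists 0; exists 0.
  by rewrite !comp0m Z0 Z0'.
- by move=> A B P [XA YA] [XB YB]; split; [apply: Xs | apply: Ys].
Qed.

Definition factors (C : preaddCat) (W : C -> Prop) (A B : C) (f : hom A B)
    : Prop :=
  exists (N : C) (g : hom A N) (h : hom N B), W N /\ f = h \co g.

Section QuotientCategory.

Variables (C : preaddCat) (addC : is_additive C).
Variables (P : C -> Prop) (W : C -> Prop) (subW : is_subcat W).

Definition factor_ideal (A B : C) : pred (hom A B) := fun f => `[< factors W f >].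

Lemma factor_ideal_closed (A B : C) : zmod_closed (@factor_ideal A B).
Proof.
split.
  have [Z _ WZ] := subcat_zero subW.
  by apply/asboolP; exists Z, 0, 0; rewrite comp0m.
move=> f f' /asboolP[N [g [h [WN ->]]]] /asboolP[N' [g' [h' [WN' ->]]]].
have [S] := addC.2 N N'.
apply/asboolP; exists S, (in1 S \co g + in2 S \co g'),
  (h \co pr1 S - h' \co pr2 S); split; first exact: subcat_sum subW _ _ S WN WN'.
rewrite compDr !compDl !compNm !compA -!(compA h) -!(compA h').
rewrite pr1_in1 pr1_in2 pr2_in1 pr2_in2 !comp1m !comp0m !compm0.
by rewrite oppr0 addr0 add0r.
Qed.

Definition factor_zmod (A B : C) : zmodClosed (hom A B) :=
  HB.pack_for (zmodClosed (hom A B)) (@factor_ideal A B)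
    (GRing.isZmodClosed.Build (hom A B) (@factor_ideal A B)
       (@factor_ideal_closed A B)).

Definition quot_obj : Type := {M : C | P M}.

Definition quot_hom (M N : quot_obj) : zmodType :=
  Quotient.quot (@factor_zmod (sval M) (sval N)).

Definition quot_pi (M N : quot_obj) (f : hom (sval M) (sval N)) : quot_hom M N :=
  \pi_(Quotient.quot (@factor_zmod (sval M) (sval N))) f.

Definition quot_repr (M N : quot_obj) (f : quot_hom M N) :
  hom (sval M) (sval N) := repr (f : Quotient.quot (@factor_zmod _ _)).

Lemma quot_reprK (M N : quot_obj) (f : quot_hom M N) : quot_pi (quot_repr f) = f.
Proof. exact: reprK. Qed.

Lemma quot_piP (M N : quot_obj) (f g : hom (sval M) (sval N)) :
  quot_pi f = quot_pi g <-> factors W (f - g).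
Proof.
split=> [/eqP|fW]; first by rewrite -Quotient.idealrBE => /asboolP.
by apply/eqP; rewrite -Quotient.idealrBE; apply/asboolP.
Qed.

Lemma quot_piD (M N : quot_obj) (f g : hom (sval M) (sval N)) :
  quot_pi (f + g) = quot_pi f + quot_pi g.
Proof. by rewrite /quot_pi raddfD. Qed.

Definition quot_id (M : quot_obj) : quot_hom M M := quot_pi (idm (sval M)).

Definition quot_comp (M N L : quot_obj) (g : quot_hom N L) (f : quot_hom M N) :
  quot_hom M L := quot_pi (quot_repr g \co quot_repr f).

Lemma quot_compE (M N L : quot_obj) (g : hom (sval N) (sval L))
    (f : hom (sval M) (sval N)) :
  quot_comp (quot_pi g) (quot_pi f) = quot_pi (g \co f).
Proof.
have /quot_piP[S [a [b [WS e]]]] := quot_reprK (quot_pi g).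
have /quot_piP[S' [a' [b' [WS' e']]]] := quot_reprK (quot_pi f).
set g' := quot_repr _ in e *; set f' := quot_repr _ in e' *.
rewrite /quot_comp -/g' -/f'.
have -> : g' = g + b \co a by rewrite -e addrC subrK.
have -> : f' = f + b' \co a' by rewrite -e' addrC subrK.
rewrite compDl compDr -addrA quot_piD; apply/eqP.
rewrite -subr_eq0 addrAC subrr add0r; apply/eqP.
have -> : 0 = quot_pi (0 : hom (sval M) (sval L)) by rewrite /quot_pi raddf0.
have T (A : C) (u : hom A (sval L)) (v : hom (sval M) A) :
  W A -> quot_pi (u \co v) = quot_pi (0 : hom (sval M) (sval L)).
  by move=> WA; apply/quot_piP; rewrite subr0; exists A, v, u.
by rewrite quot_piD compA (T _ _ _ WS') -compA (T _ _ _ WS) /quot_pi raddf0 addr0.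
Qed.

Lemma quot_comp1m (M N : quot_obj) (f : quot_hom M N) :
  quot_comp (quot_id N) f = f.
Proof. by rewrite -[f]quot_reprK quot_compE comp1m. Qed.

Lemma quot_compm1 (M N : quot_obj) (f : quot_hom M N) :
  quot_comp f (quot_id M) = f.
Proof. by rewrite -[f]quot_reprK quot_compE compm1. Qed.

Lemma quot_compA (M N L K : quot_obj) (h : quot_hom L K) (g : quot_hom N L)
    (f : quot_hom M N) :
  quot_comp h (quot_comp g f) = quot_comp (quot_comp h g) f.
Proof.
rewrite -[f]quot_reprK -[g]quot_reprK -[h]quot_reprK.
by rewrite !quot_compE compA.
Qed.

Lemma quot_compDl (M N L : quot_obj) (g g' : quot_hom N L) (f : quot_hom M N) :
  quot_comp (g + g') f = quot_comp g f + quot_comp g' f.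
Proof.
rewrite -[f]quot_reprK -[g]quot_reprK -[g']quot_reprK.
by rewrite -quot_piD !quot_compE compDl quot_piD.
Qed.

Lemma quot_compDr (M N L : quot_obj) (g : quot_hom N L) (f f' : quot_hom M N) :
  quot_comp g (f + f') = quot_comp g f + quot_comp g f'.
Proof.
rewrite -[f]quot_reprK -[g]quot_reprK -[f']quot_reprK.
by rewrite -quot_piD !quot_compE compDr quot_piD.
Qed.

(* The full subcategory on P modulo the morphisms factoring through W. *)
Definition quot_cat : preaddCat :=
  @PreaddCat quot_obj quot_hom quot_id quot_comp
    quot_comp1m quot_compm1 quot_compA quot_compDl quot_compDr.

End QuotientCategory.

(* Exactly what is needed for F to induce a functor P/W -> P'/W'. *)
Definition descends (C D : preaddCat) (F : functor C D)
    (P W : C -> Prop) (P' W' : D -> Prop) : Prop :=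
  (forall M : C, P M -> P' (F M)) /\
  (forall (M N : C) (f : hom M N), P M -> P N -> factors W f ->
     factors W' (fmor F f)).

Section QuotientFunctor.

Variables (C D : preaddCat) (addC : is_additive C) (addD : is_additive D).
Variables (P W : C -> Prop) (subW : is_subcat W).
Variables (P' W' : D -> Prop) (subW' : is_subcat W').
Variables (F : functor C D) (dF : descends F P W P' W').

Let Q := quot_cat addC P subW.
Let Q' := quot_cat addD P' subW'.

Definition quot_fobj (M : Q) : Q' := exist _ (F (sval M)) (dF.1 _ (svalP M)).

Definition quot_fmor (M N : Q) (f : hom M N) : hom (quot_fobj M) (quot_fobj N) :=
  @quot_pi D addD P' W' subW' (quot_fobj M) (quot_fobj N)
    (fmor F (quot_repr f)).

Lemma fmorB (A B : C) (f g : hom A B) : fmor F (f - g) = fmor F f - fmor F g.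
Proof. by apply/eqP; rewrite eq_sym subr_eq -fmorD subrK. Qed.

Lemma quot_fmorE (M N : Q) (f : hom (sval M) (sval N)) :
  quot_fmor (quot_pi addC subW f : hom M N) =
  @quot_pi D addD P' W' subW' (quot_fobj M) (quot_fobj N) (fmor F f).
Proof.
apply/quot_piP; rewrite -fmorB; apply: dF.2; [exact: svalP M|exact: svalP N|].
by apply/quot_piP; rewrite quot_reprK.
Qed.

Lemma quot_fmor1 (M : Q) : quot_fmor (idm M) = idm (quot_fobj M).
Proof. by rewrite [LHS]quot_fmorE fmor1. Qed.

Lemma quot_fmorM (M N L : Q) (g : hom N L) (f : hom M N) :
  quot_fmor (g \co f) = quot_fmor g \co quot_fmor f.
Proof.
have -> : g \co f = quot_pi addC subW (quot_repr g \co quot_repr f) :> hom M L.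
  by [].
by rewrite quot_fmorE fmorM; apply/esym; exact: quot_compE.
Qed.

Lemma quot_fmorD (M N : Q) (f g : hom M N) :
  quot_fmor (f + g) = quot_fmor f + quot_fmor g.
Proof.
rewrite -[f]quot_reprK -[g]quot_reprK -quot_piD !quot_fmorE fmorD.
exact: quot_piD.
Qed.

Definition quot_functor : functor Q Q' :=
  @Functor Q Q' quot_fobj quot_fmor quot_fmor1 quot_fmorM quot_fmorD.

End QuotientFunctor.

(* Data of an extriangulated category.  [ext C A] is the group E(C,A), [push a]
   and [pull c] are a_* and c^*, and [realizes x y d] says that the sequence
   A -x-> B -y-> C belongs to the class s(d). *)
Record preExtri := PreExtri {
  ecat :> preaddCat;
  ext : ecat -> ecat -> zmodType;
  push : forall C A A' : ecat, hom A A' -> ext C A -> ext C A';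
  pull : forall C C' A : ecat, hom C' C -> ext C A -> ext C' A;
  realizes : forall A B C : ecat, hom A B -> hom B C -> ext C A -> Prop
}.

Section Extriangulated.

Variable T : preExtri.

Record is_biadditive : Prop := IsBiadditive {
  push1 : forall (C A : T) (d : ext C A), push (idm A) d = d;
  pull1 : forall (C A : T) (d : ext C A), pull (idm C) d = d;
  pushM : forall (C A A' A'' : T) (a' : hom A' A'') (a : hom A A') (d : ext C A),
    push (a' \co a) d = push a' (push a d);
  pullM : forall (C C' C'' A : T) (c : hom C' C) (c' : hom C'' C') (d : ext C A),
    pull (c \co c') d = pull c' (pull c d);
  push_pull : forall (C C' A A' : T) (a : hom A A') (c : hom C' C) (d : ext C A),
    push a (pull c d) = pull c (push a d);
  pushDr : forall (C A A' : T) (a : hom A A') (d d' : ext C A),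
    push a (d + d') = push a d + push a d';
  pullDr : forall (C C' A : T) (c : hom C' C) (d d' : ext C A),
    pull c (d + d') = pull c d + pull c d';
  pushDl : forall (C A A' : T) (a a' : hom A A') (d : ext C A),
    push (a + a') d = push a d + push a' d;
  pullDl : forall (C C' A : T) (c c' : hom C' C) (d : ext C A),
    pull (c + c') d = pull c d + pull c' d
}.

Definition ext_morphism (A C A' C' : T) (d : ext C A) (d' : ext C' A')
    (a : hom A A') (c : hom C C') : Prop := push a d = pull c d'.

Definition seq_equiv (A B B' C : T) (x : hom A B) (y : hom B C)
    (x' : hom A B') (y' : hom B' C) : Prop :=
  exists b : hom B B', [/\ is_iso b, b \co x = x' & y' \co b = y].

Definition ext_sum (A C A' C' : T) (PC : biproduct C C') (PA : biproduct A A')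
    (d : ext C A) (d' : ext C' A') : ext PC PA :=
  push (in1 PA) (pull (pr1 PC) d) + push (in2 PA) (pull (pr2 PC) d').

Record is_additive_realization : Prop := IsAdditiveRealization {
  real_class : forall (A C : T) (d : ext C A),
    exists (B : T) (x : hom A B) (y : hom B C),
      forall (B' : T) (x' : hom A B') (y' : hom B' C),
        realizes x' y' d <-> seq_equiv x y x' y';
  real_lift : forall (A B C A' B' C' : T)
      (x : hom A B) (y : hom B C) (d : ext C A)
      (x' : hom A' B') (y' : hom B' C') (d' : ext C' A')
      (a : hom A A') (c : hom C C'),
    realizes x y d -> realizes x' y' d' -> ext_morphism d d' a c ->
    exists b : hom B B', b \co x = x' \co a /\ c \co y = y' \co b;
  real_zero : forall (A C : T) (P : biproduct A C),
    realizes (in1 P) (pr2 P) (0 : ext C A);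
  real_sum : forall (A B C A' B' C' : T)
      (x : hom A B) (y : hom B C) (d : ext C A)
      (x' : hom A' B') (y' : hom B' C') (d' : ext C' A')
      (PA : biproduct A A') (PB : biproduct B B') (PC : biproduct C C'),
    realizes x y d -> realizes x' y' d' ->
    realizes (bimap PA PB x x') (bimap PB PC y y') (ext_sum PC PA d d')
}.

Definition ET3 : Prop :=
  forall (A B C A' B' C' : T)
    (x : hom A B) (y : hom B C) (d : ext C A)
    (x' : hom A' B') (y' : hom B' C') (d' : ext C' A')
    (a : hom A A') (b : hom B B'),
  realizes x y d -> realizes x' y' d' -> b \co x = x' \co a ->
  exists c : hom C C', c \co y = y' \co b /\ ext_morphism d d' a c.

Definition ET3op : Prop :=
  forall (A B C A' B' C' : T)
    (x : hom A B) (y : hom B C) (d : ext C A)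
    (x' : hom A' B') (y' : hom B' C') (d' : ext C' A')
    (b : hom B B') (c : hom C C'),
  realizes x y d -> realizes x' y' d' -> c \co y = y' \co b ->
  exists a : hom A A', b \co x = x' \co a /\ ext_morphism d d' a c.

Definition ET4 : Prop :=
  forall (A B C D F : T)
    (f : hom A B) (f' : hom B D) (d1 : ext D A)
    (g : hom B C) (g' : hom C F) (d2 : ext F B),
  realizes f f' d1 -> realizes g g' d2 ->
  exists (E : T) (h' : hom C E) (d3 : ext E A) (d : hom D E) (e : hom E F),
    realizes (g \co f) h' d3 /\
    d \co f' = h' \co g /\ e \co h' = g' /\
    realizes d e (push f' d2) /\
    pull d d3 = d1 /\ push f d3 = pull e d2.

Definition ET4op : Prop :=
  forall (A B C D F : T)
    (f' : hom D B) (f : hom B A) (d1 : ext A D)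
    (g' : hom F C) (g : hom C B) (d2 : ext B F),
  realizes f' f d1 -> realizes g' g d2 ->
  exists (E : T) (h' : hom E C) (d3 : ext A E) (d : hom E D) (e : hom F E),
    realizes h' (f \co g) d3 /\
    f' \co d = g \co h' /\ h' \co e = g' /\
    realizes e d (pull f' d2) /\
    push d d3 = d1 /\ pull f d3 = push e d2.

Record is_extriangulated : Prop := IsExtriangulated {
  extri_additive : is_additive T;
  extri_biadditive : is_biadditive;
  extri_real : is_additive_realization;
  extri_ET3 : ET3;
  extri_ET3op : ET3op;
  extri_ET4 : ET4;
  extri_ET4op : ET4op
}.

End Extriangulated.

Record extri := Extri {
  epre :> preExtri;
  extriP : is_extriangulated epre
}.

Section ExtriTheory.

Variable T : extri.

Definition triangle (A B C : T) (x : hom A B) (y : hom B C) : Prop :=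
  exists d : ext C A, realizes x y d.

Definition inflation (A B : T) (x : hom A B) : Prop :=
  exists (C : T) (y : hom B C), triangle x y.

Definition deflation (B C : T) (y : hom B C) : Prop :=
  exists (A : T) (x : hom A B), triangle x y.

Definition compatible (A B : T) (f : hom A B) : Prop :=
  inflation f -> deflation f -> is_iso f.

Definition WIC : Prop :=
  forall (A B C : T) (f : hom A B) (g : hom B C),
    (inflation (g \co f) -> inflation f) /\ (deflation (g \co f) -> deflation g).

Definition projective (P : T) : Prop :=
  forall (B C : T) (y : hom B C) (f : hom P C), deflation y ->
    exists g : hom P B, y \co g = f.

Definition injective_obj (I : T) : Prop :=
  forall (A B : T) (x : hom A B) (f : hom A I), inflation x ->
    exists g : hom B I, g \co x = f.

Definition enough_projectives : Prop :=
  forall M : T, exists (A P : T) (x : hom A P) (y : hom P M),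
    projective P /\ triangle x y.

Definition enough_injectives : Prop :=
  forall M : T, exists (I A : T) (x : hom M I) (y : hom I A),
    injective_obj I /\ triangle x y.

Definition standing : Prop := [/\ WIC, enough_projectives & enough_injectives].

Definition right_exact_seq (A B C : T) (f : hom A B) (g : hom B C) : Prop :=
  exists (K : T) (h1 : hom A K) (h2 : hom K B),
    [/\ triangle h2 g, compatible h1, deflation h1 & f = h2 \co h1].

Definition left_exact_seq (A B C : T) (f : hom A B) (g : hom B C) : Prop :=
  exists (K : T) (h1 : hom K C) (h2 : hom B K),
    [/\ triangle f h2, compatible h1, inflation h1 & g = h1 \co h2].

Definition right_exact_seq4 (A B C D : T) (f : hom A B) (g : hom B C)
    (h : hom C D) : Prop :=
  exists (K : T) (g1 : hom B K) (g2 : hom K C),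
    [/\ triangle f g1, triangle g2 h, g = g2 \co g1 & compatible g1].

Definition left_exact_seq4 (A B C D : T) (f : hom A B) (g : hom B C)
    (h : hom C D) : Prop :=
  exists (K : T) (g1 : hom B K) (g2 : hom K C),
    [/\ triangle f g1, triangle g2 h, g = g2 \co g1 & compatible g2].

Record is_cotorsion_pair (X Y : T -> Prop) : Prop := IsCotorsionPair {
  cot_subX : is_subcat X;
  cot_subY : is_subcat Y;
  cot_sumX : summand_closed X;
  cot_sumY : summand_closed Y;
  cot_CP1 : forall (M N : T), X M -> Y N -> forall d : ext M N, d = 0;
  cot_CP2l : forall C : T, exists (Y1 X1 : T) (x : hom Y1 X1) (y : hom X1 C),
    [/\ Y Y1, X X1 & triangle x y];
  cot_CP2r : forall C : T, exists (Y1 X1 : T) (x : hom C Y1) (y : hom Y1 X1),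
    [/\ Y Y1, X X1 & triangle x y]
}.

Definition cplus (X Y : T -> Prop) (C : T) : Prop :=
  exists (N W : T) (x : hom N W) (y : hom W C),
    [/\ Y N, inter X Y W & triangle x y].

Definition cminus (X Y : T -> Prop) (C : T) : Prop :=
  exists (W N : T) (x : hom C W) (y : hom W N),
    [/\ inter X Y W, X N & triangle x y].

Definition heart_obj (X Y : T -> Prop) : T -> Prop :=
  inter (cplus X Y) (cminus X Y).

Lemma cot_subXY (X Y : T -> Prop) :
  is_cotorsion_pair X Y -> is_subcat (inter X Y).
Proof. by move=> h; apply: inter_subcat (cot_subX h) (cot_subY h). Qed.

Definition heart (X Y : T -> Prop) (h : is_cotorsion_pair X Y) : preaddCat :=
  quot_cat (extri_additive (extriP T)) (heart_obj X Y) (cot_subXY h).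

End ExtriTheory.

Section HeartFunctor.

Variables (T T' : extri) (F : functor T T').
Variables (X Y : T -> Prop) (X' Y' : T' -> Prop).

Definition descends_to_hearts : Prop :=
  descends F (heart_obj X Y) (inter X Y) (heart_obj X' Y') (inter X' Y').

Definition heart_functor (h : is_cotorsion_pair X Y)
    (h' : is_cotorsion_pair X' Y') (dF : descends_to_hearts) :
    functor (heart h) (heart h') :=
  quot_functor (extri_additive (extriP T)) (extri_additive (extriP T'))
    (cot_subXY h) (cot_subXY h') dF.

End HeartFunctor.

Section ExactFunctors.

Variables (T T' : extri) (F : functor T T').

Definition preserves_compatible : Prop :=
  forall (A B : T) (f : hom A B), compatible f -> compatible (fmor F f).

Record ext_transformation := ExtTransformation {
  eta :> forall C A : T, ext C A -> ext (F C) (F A);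
  etaD : forall (C A : T) (d d' : ext C A), eta (d + d') = eta d + eta d';
  eta_push : forall (C A A' : T) (a : hom A A') (d : ext C A),
    eta (push a d) = push (fmor F a) (eta d);
  eta_pull : forall (C C' A : T) (c : hom C' C) (d : ext C A),
    eta (pull c d) = pull (fmor F c) (eta d)
}.

Definition is_exact : Prop :=
  preserves_compatible /\
  exists t : ext_transformation,
    forall (A B C : T) (f : hom A B) (g : hom B C) (d : ext C A),
      realizes f g d -> realizes (fmor F f) (fmor F g) (t C A d).

(* The object A' in the triangle A' -> FB -> FC attached to an extension d in
   E(C,A) depends on d, not only on A; so eta is a family of extensions
   eta(d) in E(FC, A'_d) and its naturality says that every morphism of
   extensions (a, c) : d -> d' induces one, (a', Fc) : eta(d) -> eta(d'), where
   a' is compatible with F a through the deflations F A -> A'_d. *)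
Record right_ext_transformation := RightExtTransformation {
  reta_obj : forall C A : T, ext C A -> T';
  reta_defl : forall (C A : T) (d : ext C A), hom (F A) (reta_obj d);
  reta : forall (C A : T) (d : ext C A), ext (F C) (reta_obj d);
  reta_deflP : forall (C A : T) (d : ext C A),
    deflation (reta_defl d) /\ compatible (reta_defl d);
  reta_real : forall (A B C : T) (f : hom A B) (g : hom B C) (d : ext C A),
    realizes f g d ->
    exists x : hom (reta_obj d) (F B),
      realizes x (fmor F g) (reta d) /\ fmor F f = x \co reta_defl d;
  reta_nat : forall (A C A' C' : T) (d : ext C A) (d' : ext C' A')
      (a : hom A A') (c : hom C C'),
    ext_morphism d d' a c ->
    exists a' : hom (reta_obj d) (reta_obj d'),
      a' \co reta_defl d = reta_defl d' \co fmor F a /\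
      ext_morphism (reta d) (reta d') a' (fmor F c)
}.

Definition right_exact : Prop :=
  [/\ preserves_compatible,
      forall (A B C : T) (f : hom A B) (g : hom B C),
        right_exact_seq f g -> right_exact_seq (fmor F f) (fmor F g)
    & inhabited right_ext_transformation].

Record left_ext_transformation := LeftExtTransformation {
  leta_obj : forall C A : T, ext C A -> T';
  leta_infl : forall (C A : T) (d : ext C A), hom (leta_obj d) (F C);
  leta : forall (C A : T) (d : ext C A), ext (leta_obj d) (F A);
  leta_inflP : forall (C A : T) (d : ext C A),
    inflation (leta_infl d) /\ compatible (leta_infl d);
  leta_real : forall (A B C : T) (f : hom A B) (g : hom B C) (d : ext C A),
    realizes f g d ->
    exists y : hom (F B) (leta_obj d),
      realizes (fmor F f) y (leta d) /\ fmor F g = leta_infl d \co y;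
  leta_nat : forall (A C A' C' : T) (d : ext C A) (d' : ext C' A')
      (a : hom A A') (c : hom C C'),
    ext_morphism d d' a c ->
    exists c' : hom (leta_obj d) (leta_obj d'),
      leta_infl d' \co c' = fmor F c \co leta_infl d /\
      ext_morphism (leta d) (leta d') (fmor F a) c'
}.

Definition left_exact : Prop :=
  [/\ preserves_compatible,
      forall (A B C : T) (f : hom A B) (g : hom B C),
        left_exact_seq f g -> left_exact_seq (fmor F f) (fmor F g)
    & inhabited left_ext_transformation].

End ExactFunctors.

(* i_low = i_*, i_up = i^*, i_shr = i^!, j_shr = j_!, j_up = j^*, j_low = j_* *)
Record recollement (A B C : extri) := Recollement {
  i_low : functor A B;
  i_up : functor B A;
  i_shr : functor B A;
  j_shr : functor C B;
  j_up : functor B C;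
  j_low : functor C B;
  exact_ilow : is_exact i_low;
  exact_jup : is_exact j_up;
  rexact_iup : right_exact i_up;
  rexact_jshr : right_exact j_shr;
  lexact_ishr : left_exact i_shr;
  lexact_jlow : left_exact j_low;
  adj_iup_ilow : adjunction i_up i_low;
  adj_ilow_ishr : adjunction i_low i_shr;
  adj_jshr_jup : adjunction j_shr j_up;
  adj_jup_jlow : adjunction j_up j_low;
  recol_im_ker : image_is_kernel i_low j_up;
  ff_ilow : fully_faithful i_low;
  ff_jshr : fully_faithful j_shr;
  ff_jlow : fully_faithful j_low;
  recol_R4 : forall M : B, exists (N : A) (h : hom (j_low (j_up M)) (i_low N)),
    left_exact_seq4 (adj_counit adj_ilow_ishr M) (adj_unit adj_jup_jlow M) h;
  recol_R5 : forall M : B, exists (N : A) (h : hom (i_low N) (j_shr (j_up M))),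
    right_exact_seq4 h (adj_counit adj_jshr_jup M) (adj_unit adj_iup_ilow M)
}.

(* Main.v *)
From HB Require Import structures.
From mathcomp Require Import all_boot all_algebra.
From mathcomp Require Import boolp.
Require Import Defs.

Set Implicit Arguments.
Unset Strict Implicit.
Unset Printing Implicit Defensive.

Import GRing.Theory.
Local Open Scope ring_scope.

(**
The theorem has two halves: hearts of cotorsion pairs are abelian, and the six
functors descend to hearts as a recollement.  In both, one of two dual
statements is proved and the other is read off in the opposite category
[opext T], in which X and Y exchange their roles.

Abelian hearts.  In the heart an inflation whose cone lies in X is an
epimorphism ([inflation_in_epi]), and dually a deflation whose fibre lies in Y
is a monomorphism.  Given f : A -> B, push an embedding of A into an object of
X and Y out along f and reflect the result into B^+ ([cplus_reflection]).  The
composite from B is an inflation with cone in X, and it is the cokernel of f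
([heart_cokernel]).  Conversely each inflation between heart objects with cone
in X is the cokernel of a pulled back approximation
([inflation_in_cokernel]), so it splits, and is invertible in the heart, once
it is mono there ([inflation_in_mono_split]).  For an epimorphism f of the
heart, WIC allows replacing f by a deflation; pushing its fibre into an object
of Y factors it as an inflation with cone in X followed by a deflation with
fibre in Y ([pushout_inflations]).  The second factor is epi and mono, hence
invertible, and the first one is a cokernel: so f is a cokernel
([heart_epi_cokernel]).

Recollement.  As i^* j_! = 0 and i^! j_* = 0, exactness of i^* and i^! forces
the outer terms of the four-term sequences to vanish.  This leaves triangles
i_* i^! M -> M -> j_* j^* M and j_! j^* M -> M -> i_* i^* M
([ishr_triangle], [iup_triangle]), and makes j_! and j_* preserve triangles.
Ext-vanishing passes through adjunctions ([adj_ext_left], [adj_ext_right]);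
this gives i_* i^! Y in Y and j_! j^* X in X, the two stability conditions that
are not assumed.  The two outer pairs then are the preimages of (X, Y) under
i_* and j_* ([cotorsion_transfer]), and all six functors respect the classes,
so they descend.  Units and counits descend with them; the invertible ones
stay invertible, which gives full faithfulness.

Finally let M in the heart have j^* M = 0 there.  Then j^* M, hence j_! j^* M
and j_* j^* M, lie in X and Y.  By the two triangles M -> i_* i^* M is mono and
i_* i^! M -> M is epi.  The unit M -> i_* i^* M composed with this epimorphism
is i_* i^* of it up to an isomorphism, hence epi, so the unit is invertible and
M is in the image of i_*.
*)

(** * Duality *)

Definition opcat (C : preaddCat) : preaddCat :=
  @PreaddCat C (fun A B => hom B A) (@idm C) (fun A B D g f => f \co g)
    (fun A B f => compm1 f) (fun A B f => comp1m f)
    (fun A B D E h g f => esym (compA f g h))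
    (fun A B D g g' f => compDr f g g') (fun A B D g f f' => compDl f f' g).

Definition biprod_op (C : preaddCat) (A B : C) (P : biproduct A B) :
  @biproduct (opcat C) A B :=
  @Biproduct (opcat C) A B P (pr1 P) (pr2 P) (in1 P) (in2 P)
    (pr1_in1 P) (pr2_in2 P) (pr2_in1 P) (pr1_in2 P) (bp_sum P).

Definition biprod_unop (C : preaddCat) (A B : C)
    (P : @biproduct (opcat C) A B) :
  biproduct A B :=
  @Biproduct C A B (bp P) (pr1 P) (pr2 P) (in1 P) (in2 P)
    (pr1_in1 P) (pr2_in2 P) (pr2_in1 P) (pr1_in2 P) (bp_sum P).

Definition biprod_swap (C : preaddCat) (A B : C) (P : biproduct A B) :
  biproduct B A :=
  @Biproduct C B A P (in2 P) (in1 P) (pr2 P) (pr1 P)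
    (pr2_in2 P) (pr1_in1 P) (pr2_in1 P) (pr1_in2 P)
    (etrans (addrC _ _) (bp_sum P)).

Lemma is_iso_op (C : preaddCat) (A B : C) (f : hom A B) :
  @is_iso (opcat C) B A f <-> is_iso f.
Proof. by split=> -[g [e1 e2]]; exists g. Qed.

Lemma isomorphic_sym (C : preaddCat) (A B : C) :
  isomorphic A B -> isomorphic B A.
Proof. by move=> [f [g [gf fg]]]; exists g, f. Qed.

Lemma isomorphic_op (C : preaddCat) (A B : C) :
  @isomorphic (opcat C) A B -> @isomorphic C A B.
Proof. by move=> [f [g [gf fg]]]; exists g, f. Qed.

Lemma is_additive_op (C : preaddCat) : is_additive C -> is_additive (opcat C).
Proof.
move=> [Z0 S]; split=> // A B; have [P] := S A B.
by constructor; apply: biprod_op.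
Qed.

Definition oppre (T : preExtri) : preExtri :=
  @PreExtri (opcat T) (fun C A => ext A C)
    (fun C A A' a d => pull a d) (fun C C' A c d => push c d)
    (fun A B C x y d => realizes y x d).

Lemma seq_equiv_op (T : preExtri) (A B B' C : T) (x : hom A B) (y : hom B C)
    (x' : hom A B') (y' : hom B' C) :
  @seq_equiv (oppre T) C B B' A y x y' x' <-> seq_equiv x y x' y'.
Proof.
split.
  move=> [b [/is_iso_op [c [cb bc]] e1 e2]]; exists c; split.
  - by exists b.
  - by rewrite -[x]e2; apply: etrans (compA _ _ _) _; rewrite cb comp1m.
  - by rewrite -[y']e1; apply: etrans (esym (compA _ _ _)) _; rewrite bc compm1.
move=> [b [[c [cb bc]] e1 e2]]; exists c; split.
- by apply/is_iso_op; exists b.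
- by change (y \co c = y'); rewrite -e2 -compA bc compm1.
- by change (c \co x' = x); rewrite -e1 compA cb comp1m.
Qed.

Lemma is_extriangulated_op (T : preExtri) :
  is_extriangulated T -> is_extriangulated (oppre T).
Proof.
move=> [addT [p1 l1 pM lM pl pDr lDr pDl lDl] [rc rl rz rs] e3 e3o e4 e4o].
split.
- exact: is_additive_op.
- split=> /=.
  + by move=> C A d; apply: l1.
  + by move=> C A d; apply: p1.
  + by move=> C A A' A'' a' a d; apply: lM.
  + by move=> C C' C'' A c c' d; apply: pM.
  + by move=> C C' A A' a c d; apply/esym/pl.
  + by move=> C A A' a d d'; apply: lDr.
  + by move=> C C' A c d d'; apply: pDr.
  + by move=> C A A' a a' d; apply: lDl.
  + by move=> C C' A c c' d; apply: pDl.
- split.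
  + move=> A C d; have [B [x [y h]]] := rc _ _ d.
    exists B, y, x => B' x' y'; apply: iff_trans (h _ _ _) _.
    exact: iff_sym (seq_equiv_op _ _ _ _).
  + move=> A B C A' B' C' x y d x' y' d' a c h h' m.
    have [b [e1 e2]] := rl _ _ _ _ _ _ _ _ _ _ _ _ _ _ h' h (esym m).
    by exists b; split; apply/esym.
  + by move=> A C P; apply: (rz C A (biprod_swap (biprod_unop P))).
  + move=> A B C A' B' C' x y d x' y' d' PA PB PC h h'.
    have := rs _ _ _ _ _ _ _ _ _ _ _ _
      (biprod_unop PC) (biprod_unop PB) (biprod_unop PA) h h'.
    rewrite /ext_sum /bimap /= !pl -!compA; exact.
- move=> A B C A' B' C' x y d x' y' d' a b h h' e.
  have [c [e1 e2]] := e3o _ _ _ _ _ _ _ _ _ _ _ _ _ _ h' h (esym e).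
  by exists c; split; apply/esym.
- move=> A B C A' B' C' x y d x' y' d' b c h h' e.
  have [a [e1 e2]] := e3 _ _ _ _ _ _ _ _ _ _ _ _ _ _ h' h (esym e).
  by exists a; split; apply/esym.
- move=> A B C D F f f' d1 g g' d2 h1 h2.
  have [E [h' [d3 [d [e [r1 [r2 [r3 [r4 [r5 r6]]]]]]]]]] :=
    e4o _ _ _ _ _ _ _ _ _ _ _ h1 h2.
  by exists E, h', d3, d, e.
- move=> A B C D F f f' d1 g g' d2 h1 h2.
  have [E [h' [d3 [d [e [r1 [r2 [r3 [r4 [r5 r6]]]]]]]]]] :=
    e4 _ _ _ _ _ _ _ _ _ _ _ h1 h2.
  by exists E, h', d3, d, e.
Qed.

(** All notions attached to T (triangles, cotorsion pairs, hearts) turn into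
    their duals when read in this category, mostly up to conversion. *)
Definition opext (T : extri) : extri := Extri (is_extriangulated_op (extriP T)).

(** * Exact sequences attached to an E-triangle *)

Section Triangles.

Variable T : extri.
Implicit Types A B C M : T.

Let bi := extri_biadditive (extriP T).
Let re := extri_real (extriP T).
Let addT := extri_additive (extriP T).

Lemma compBl A B C (g g' : hom B C) (f : hom A B) :
  (g - g') \co f = g \co f - g' \co f.
Proof. by rewrite compDl compNm. Qed.

Lemma compBr A B C (g : hom B C) (f f' : hom A B) :
  g \co (f - f') = g \co f - g \co f'.
Proof. by rewrite compDr compmN. Qed.

Lemma push_comp C A A' A'' (a' : hom A' A'') (a : hom A A') (d : ext C A) :
  push a' (push a d) = push (a' \co a) d.
Proof. exact/esym/(pushM bi). Qed.

Lemma pull_comp C C' C'' A (c : hom C' C) (c' : hom C'' C') (d : ext C A) :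
  pull c' (pull c d) = pull (c \co c') d.
Proof. exact/esym/(pullM bi). Qed.

Lemma push_zero C A A' (a : hom A A') : push a (0 : ext C A) = 0.
Proof. by apply: (@addrI _ (push a 0)); rewrite -(pushDr bi) !addr0. Qed.

Lemma pull_zero C C' A (c : hom C' C) : pull c (0 : ext C A) = 0.
Proof. by apply: (@addrI _ (pull c 0)); rewrite -(pullDr bi) !addr0. Qed.

Lemma zero_pull C C' A (d : ext C A) : pull (0 : hom C' C) d = 0.
Proof. by apply: (@addrI _ (pull 0 d)); rewrite -(pullDl bi) !addr0. Qed.

Lemma pushBl C A A' (a a' : hom A A') (d : ext C A) :
  push (a - a') d = push a d - push a' d.
Proof.
by apply: (@addIr _ (push a' d)); rewrite -(pushDl bi) !subrK.
Qed.

Lemma pullBr C C' A (c : hom C' C) (d d' : ext C A) :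
  pull c (d - d') = pull c d - pull c d'.
Proof.
by apply: (@addIr _ (pull c d')); rewrite -(pullDr bi) !subrK.
Qed.

Lemma realization_exists C A (d : ext C A) :
  exists B (x : hom A B) (y : hom B C), realizes x y d.
Proof.
have [B [x [y h]]] := real_class re d; exists B, x, y; apply/h.
by exists (idm B); rewrite comp1m compm1; split=> //; exists (idm B);
  rewrite comp1m.
Qed.

Lemma realizes_unique C A (d : ext C A) B (x : hom A B) (y : hom B C)
    B' (x' : hom A B') (y' : hom B' C) :
  realizes x y d -> realizes x' y' d -> seq_equiv x y x' y'.
Proof.
have [B0 [x0 [y0 h]]] := real_class re d.
move=> /h [b [[c [cb bc]] <- e0]] /h [b' [ib' <- e]].
have [c' [cb' bc']] := ib'.
exists (b' \co c); split.
- exists (b \co c'); split; rewrite compA.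
    by rewrite -(compA b) cb' compm1 bc.
  by rewrite -(compA b') cb compm1 bc'.
- by rewrite -compA (compA c) cb comp1m.
- by rewrite compA e -e0 -compA bc compm1.
Qed.

Lemma realizes_equiv C A (d : ext C A) B (x : hom A B) (y : hom B C)
    B' (x' : hom A B') (y' : hom B' C) :
  realizes x y d -> seq_equiv x y x' y' -> realizes x' y' d.
Proof.
have [B0 [x0 [y0 h]]] := real_class re d.
move=> /h [b [[c [cb bc]] <- e0]] [b' [[c' [cb' bc']] <- e]]; apply/h.
exists (b' \co b); split.
- exists (c \co c'); split; rewrite compA.
    by rewrite -(compA c) cb' compm1 cb.
  by rewrite -(compA b') bc compm1 bc'.
- by rewrite compA.
- by rewrite compA e e0.
Qed.

Section OneTriangle.

Variables (A B C : T) (x : hom A B) (y : hom B C) (d : ext C A).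
Hypothesis rxy : realizes x y d.

Lemma tri_comp : y \co x = 0.
Proof.
have [[Z _] S] := addT; have [P] := S A Z.
have [b [e1 e2]] : exists b : hom P B, b \co in1 P = x \co idm A /\
    (0 : hom Z C) \co pr2 P = y \co b.
  apply: (real_lift re) (real_zero re P) rxy _.
  by rewrite /ext_morphism push_zero zero_pull.
by rewrite -[x]compm1 -e1 compA -e2 comp0m comp0m.
Qed.

Lemma tri_pull : pull y d = 0.
Proof.
have [_ S] := addT; have [P] := S A B.
have [a [_ <-]] : exists a : hom A A, (pr2 P + x \co pr1 P) \co in1 P = x \co a /\
    ext_morphism (0 : ext B A) d a y.
  apply: (extri_ET3op (extriP T)) (real_zero re P) rxy _.
  by rewrite compDr compA tri_comp comp0m addr0.
exact: push_zero.
Qed.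

Lemma tri_lift M (c : hom M C) :
  pull c d = 0 -> exists g : hom M B, y \co g = c.
Proof.
move=> c0; have [_ S] := addT; have [P] := S A M.
have [b [_ e2]] : exists b : hom P B, b \co in1 P = x \co idm A /\
    c \co pr2 P = y \co b.
  apply: (real_lift re) (real_zero re P) rxy _.
  by rewrite /ext_morphism push_zero c0.
by exists (b \co in2 P); rewrite compA -e2 -compA pr2_in2 compm1.
Qed.

Lemma tri_ker M (g : hom M B) : y \co g = 0 -> exists h : hom M A, x \co h = g.
Proof.
move=> g0; have [[Z Z0] S] := addT; have [P] := S M Z.
have [a [e _]] : exists a : hom M A, (g \co pr1 P) \co in1 P = x \co a /\
    ext_morphism (0 : ext Z M) d a (0 : hom Z C).
  apply: (extri_ET3op (extriP T)) (real_zero re P) rxy _.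
  by rewrite comp0m compA g0 comp0m.
by exists a; rewrite -e -compA pr1_in1 compm1.
Qed.

(** Let M -> N -> B realize e.  The fibre of the composite deflation N -> C is
    an extension of A by M with class x^* e = 0, so it retracts onto M; pushing
    its class along the retraction gives e'. *)
Lemma tri_ext_exact M (e : ext B M) :
  pull x e = 0 -> exists e' : ext C M, e = pull y e'.
Proof.
move=> e0; have [N [m [n rmn]]] := realization_exists e.
have [E [h [d3 [p [q [_ [_ [_ [rqp [_ e6]]]]]]]]]] :=
  extri_ET4op (extriP T) rxy rmn.
rewrite e0 in rqp.
have [P] := addT.2 M A.
have [b [ib e1 e2]] := realizes_unique rqp (real_zero re P).
have [c [cb bc]] := ib.
exists (push (pr1 P \co b) d3).
rewrite -(push_pull bi) e6 push_comp -compA e1 pr1_in1.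
by rewrite (push1 bi).
Qed.

End OneTriangle.

End Triangles.

Section Isomorphisms.

Variable C : preaddCat.
Implicit Types A B D : C.

Lemma iso_id A : is_iso (idm A).
Proof. by exists (idm A); rewrite comp1m. Qed.

Lemma iso_comp A B D (g : hom B D) (f : hom A B) :
  is_iso g -> is_iso f -> is_iso (g \co f).
Proof.
move=> [g' [e1 e2]] [f' [e3 e4]]; exists (f' \co g'); split.
  by rewrite compA -(compA f') e1 compm1.
by rewrite compA -(compA g) e4 compm1.
Qed.

Lemma iso_two_sided A B (f : hom A B) (g : hom B A) :
  is_iso (g \co f) -> is_iso (f \co g) -> is_iso f.
Proof.
move=> [u [u1 _]] [v [_ v2]].
have e : u \co g = g \co v.
  by rewrite -[u \co g]compm1 -v2 !compA -(compA u g f) u1 comp1m.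
exists (g \co v); split; last by rewrite compA.
by rewrite -e -compA.
Qed.

Lemma zero_target A B (f : hom A B) : is_zero B -> f = 0.
Proof. by move=> zB; rewrite -[f]comp1m zB comp0m. Qed.

Lemma zero_source A B (f : hom A B) : is_zero A -> f = 0.
Proof. by move=> zA; rewrite -[f]compm1 zA compm0. Qed.

Lemma iso_zero_zero A B (f : hom A B) : is_zero A -> is_zero B -> is_iso f.
Proof.
move=> A0 B0; exists 0.
by rewrite (zero_target (0 \co f) A0) (zero_target (f \co 0) B0) A0 B0.
Qed.

End Isomorphisms.

Section MoreTriangles.

Variable T : extri.
Implicit Types A B C M : T.

Let bi := extri_biadditive (extriP T).
Let re := extri_real (extriP T).

Section OneTriangle.

Variables (A B C : T) (x : hom A B) (y : hom B C) (d : ext C A).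
Hypothesis rxy : realizes x y d.

Lemma tri_push : push x d = 0.
Proof. exact: (@tri_pull (opext T) C B A y x d rxy). Qed.

Lemma tri_extend M (a : hom A M) :
  push a d = 0 -> exists g : hom B M, g \co x = a.
Proof. exact: (@tri_lift (opext T) C B A y x d rxy). Qed.

Lemma tri_coker M (g : hom B M) :
  g \co x = 0 -> exists h : hom C M, h \co y = g.
Proof. exact: (@tri_ker (opext T) C B A y x d rxy). Qed.

(** The difference f - 1 kills x and is killed by y, so it squares to zero. *)
Lemma tri_unipotent (f : hom B B) : f \co x = x -> y \co f = y -> is_iso f.
Proof.
move=> fx yf; have [t e] : exists t, t \co y = f - idm B.
  by apply: tri_coker; rewrite compBl comp1m fx subrr.
have n0 : (f - idm B) \co (f - idm B) = 0.
  by rewrite -{1}e -compA compBr yf compm1 subrr compm0.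
set n := f - idm B in e n0; have -> : f = n + idm B by rewrite subrK.
exists (idm B - n); split.
  by rewrite compBl comp1m compDr n0 compm1 add0r addrAC subrr add0r.
by rewrite compDl comp1m compBr n0 compm1 subr0 addrC subrK.
Qed.

Lemma tri_section (s : hom C B) : y \co s = idm C -> d = 0.
Proof.
by move=> e; rewrite -[d](pull1 bi) -e -pull_comp (tri_pull rxy) pull_zero.
Qed.

Lemma tri_split : d = 0 -> exists s : hom C B, y \co s = idm C.
Proof. by move=> d0; apply: (tri_lift rxy); rewrite d0 pull_zero. Qed.

Lemma tri_retraction (r : hom B A) : r \co x = idm A ->
  exists s : hom C B, [/\ y \co s = idm C, r \co s = 0 & x \co r + s \co y = idm B].
Proof.
move=> rx; have d0 : d = 0.
  by rewrite -[d](push1 bi) -rx -push_comp tri_push push_zero.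
have [s0 ys0] := tri_split d0.
have [s sy] : exists s, s \co y = idm B - x \co r.
  by apply: tri_coker; rewrite compBl comp1m -compA rx compm1 subrr.
have es : s = (idm B - x \co r) \co s0 by rewrite -sy -compA ys0 compm1.
exists s; split; last by rewrite sy addrC subrK.
  by rewrite es compA compBr compm1 compA (tri_comp rxy) comp0m subr0.
by rewrite es compA compBr compm1 compA rx comp1m subrr comp0m.
Qed.

(** Over the identity of C, a lift of y to a realization of e restricts to a map
    A -> M, and this map pushes d to e. *)
Lemma tri_connect M (e : ext C M) :
  pull y e = 0 -> exists t : hom A M, e = push t d.
Proof.
move=> e0; have [N [m [n rmn]]] := realization_exists e.
have [b nb] := tri_lift rmn e0.
have [t [_ et]] : exists a : hom A M, b \co x = m \co a /\ ext_morphism d e a (idm C).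
  by apply: (extri_ET3op (extriP T)) rxy rmn _; rewrite comp1m.
by exists t; rewrite et (pull1 bi).
Qed.

End OneTriangle.

(** The square formed by x, f, x' and b is a weak pushout: p extends along x'
    because p_* f_* d = q_* x_* d = 0, and the defect of the extension on B
    factors through y, so it can be subtracted. *)
Lemma weak_pushout A B C A' B' (x : hom A B) (y : hom B C) (d : ext C A)
    (f : hom A A') (x' : hom A' B') (y' : hom B' C)
    (b : hom B B') M (p : hom A' M) (q : hom B M) :
    realizes x y d -> realizes x' y' (push f d) ->
    b \co x = x' \co f -> y' \co b = y -> p \co f = q \co x ->
  exists r : hom B' M, r \co x' = p /\ r \co b = q.
Proof.
move=> r r' e1 e2 e3.
have [r0 r0x] : exists r0, r0 \co x' = p.
  by apply: (tri_extend r'); rewrite push_comp e3 -push_comp (tri_push r) push_zero.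
have [t ty] : exists t, t \co y = r0 \co b - q.
  by apply: (tri_coker r); rewrite compBl -compA e1 compA r0x e3 subrr.
exists (r0 - t \co y'); split.
  by rewrite compBl r0x -compA (tri_comp r') compm0 subr0.
by rewrite compBl -compA e2 ty opprB addrC subrK.
Qed.

(** The sequence is compared with a realization of c'^* d in both directions;
    the composites are unipotent, so the comparison is an isomorphism. *)
Lemma realizes_isor A B C C' (x : hom A B) (y : hom B C) (d : ext C A)
    (c : hom C C') (c' : hom C' C) :
  realizes x y d -> c' \co c = idm C -> c \co c' = idm C' ->
  realizes x (c \co y) (pull c' d).
Proof.
move=> r e1 e2; have [B' [x' [y' r']]] := realization_exists (pull c' d).
have [b [bx cy]] : exists b, b \co x = x' \co idm A /\ c \co y = y' \co b.
  apply: (real_lift re) r r' _.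
  by rewrite /ext_morphism pull_comp e1 (push1 bi) (pull1 bi).
have [b' [bx' cy']] : exists b', b' \co x' = x \co idm A /\ c' \co y' = y \co b'.
  by apply: (real_lift re) r' r _; rewrite /ext_morphism (push1 bi).
rewrite compm1 in bx; rewrite compm1 in bx'.
have ib' : is_iso b'.
  apply: (@iso_two_sided _ _ _ b' b).
    apply: (tri_unipotent r'); first by rewrite -compA bx' bx.
    by rewrite compA -cy -compA -cy' compA e2 comp1m.
  apply: (tri_unipotent r); first by rewrite -compA bx bx'.
  by rewrite compA -cy' -compA -cy compA e1 comp1m.
apply: realizes_equiv r' _; exists b'; split=> //.
by rewrite -compA -cy' compA e2 comp1m.
Qed.

Lemma triangle_isor A B C C' (x : hom A B) (y : hom B C) (c : hom C C') :
  triangle x y -> is_iso c -> triangle x (c \co y).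
Proof.
by move=> [d r] [c' [e1 e2]]; exists (pull c' d); apply: realizes_isor.
Qed.

End MoreTriangles.

Lemma triangle_isol (T : extri) (A A' B C : T) (x : hom A B) (y : hom B C)
    (a : hom A' A) :
  triangle x y -> is_iso a -> triangle (x \co a) y.
Proof.
move=> t /is_iso_op ia.
exact: (@triangle_isor (opext T) C B A A' y x a t ia).
Qed.

Lemma triangle_isom (T : extri) (A B B' C : T) (x : hom A B) (y : hom B C)
    (b : hom B B') (b' : hom B' B) :
  triangle x y -> b' \co b = idm B -> b \co b' = idm B' ->
  triangle (b \co x) (y \co b').
Proof.
move=> [d r] e1 e2; exists d; apply: realizes_equiv r _.
by exists b; split=> //; [exists b' | rewrite -compA e1 compm1].
Qed.

(** Nakaoka-Palu's lemma that the pullback M of two deflations over C is an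
    extension both of B1 and of B2.  M realizes y2^* d1; composing deflations,
    it is also an extension of C by A1 + A2, and dividing this by A1, along a
    projection corrected by a map A2 -> A1, leaves an extension with class d1. *)
Lemma pullback_deflations (T : extri) (C A1 B1 A2 B2 : T)
    (x1 : hom A1 B1) (y1 : hom B1 C) (x2 : hom A2 B2) (y2 : hom B2 C) :
  triangle x1 y1 -> triangle x2 y2 ->
  exists (M : T) (m1 : hom A1 M) (e2 : hom M B2) (m2 : hom A2 M) (e1 : hom M B1),
    [/\ triangle m1 e2, triangle m2 e1 & e1 \co m1 = x1].
Proof.
have bi := extri_biadditive (extriP T).
have re := extri_real (extriP T).
move=> [d1 r1] [d2 r2].
have [M [m1 [e2 rM]]] := realization_exists (pull y2 d1).
have [E [h [d3 [p [i [rh [_ [hi [rE [pd3 hd3]]]]]]]]]] :=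
  extri_ET4op (extriP T) r2 rM.
(* E, the fibre of M -> C, is an extension of A2 by A1; it splits as y2 x2 = 0 *)
rewrite pull_comp (tri_comp r2) zero_pull in rE.
have [r0 r0i] : exists r0, r0 \co i = idm A1.
  by apply: (tri_extend rE); rewrite push_zero.
have [t et] : exists t : hom A2 A1, push r0 d3 - d1 = push t d2.
  apply: (tri_connect r2).
  by rewrite pullBr -(push_pull bi) hd3 push_comp r0i (push1 bi) subrr.
(* the correction by t turns the class pushed along r0 into d1 *)
pose r := r0 - t \co p.
have rd3 : push r d3 = d1.
  by rewrite pushBl -push_comp pd3 -et opprB addrC subrK.
have ri : r \co i = idm A1 by rewrite compBl r0i -compA (tri_comp rE) compm0 subr0.
have [s [ps rs sum1]] := tri_retraction rE ri.
rewrite addrC in sum1.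
have r0E := real_zero re (Biproduct ps ri (tri_comp rE) rs sum1).
have [E2 [h' [d4 [dd [ee [rh' [ddr [_ [r1' _]]]]]]]]] :=
  extri_ET4 (extriP T) r0E rh.
rewrite rd3 in r1'.
have [b [ib bdd _]] := realizes_unique r1' r1.
exists M, m1, e2, (h \co s), (b \co h'); split.
- by exists (pull y2 d1).
- by apply: triangle_isor ib; exists d4.
- by rewrite -hi -compA (compA h') -ddr -(compA dd) ri compm1.
Qed.

Lemma pushout_inflations (T : extri) (C A1 B1 A2 B2 : T)
    (x1 : hom C B1) (y1 : hom B1 A1) (x2 : hom C B2) (y2 : hom B2 A2) :
  triangle x1 y1 -> triangle x2 y2 ->
  exists (M : T) (m1 : hom M A1) (e2 : hom B2 M) (m2 : hom M A2) (e1 : hom B1 M),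
    [/\ triangle e2 m1, triangle e1 m2 & m1 \co e1 = y1].
Proof. exact: (@pullback_deflations (opext T) C A1 B1 A2 B2 y1 x1 y2 x2). Qed.

(** * Cotorsion pairs *)

Section CotorsionOp.

Variables (T : extri) (X Y : T -> Prop).

Lemma is_subcat_op (C : preaddCat) (U : C -> Prop) :
  is_subcat U -> @is_subcat (opcat C) U.
Proof.
move=> [ui [Z Z0 UZ] us]; split.
- by move=> A B /isomorphic_op iAB; apply: ui.
- by exists Z.
- by move=> A B P; apply: (us A B (biprod_unop P)).
Qed.

Lemma cotorsion_op : is_cotorsion_pair X Y -> @is_cotorsion_pair (opext T) Y X.
Proof.
move=> [sX sY mX mY c1 cl cr]; split.
- exact: is_subcat_op sY.
- exact: is_subcat_op sX.
- by move=> A B P; apply: (mY A B (biprod_unop P)).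
- by move=> A B P; apply: (mX A B (biprod_unop P)).
- by move=> M N YM XN d; apply: c1.
- by move=> C; have [Y1 [X1 [x [y [h1 h2 h3]]]]] := cr C; exists X1, Y1, y, x.
- by move=> C; have [Y1 [X1 [x [y [h1 h2 h3]]]]] := cl C; exists X1, Y1, y, x.
Qed.

Lemma cplus_op (C : T) : @cplus (opext T) Y X C <-> cminus X Y C.
Proof.
split=> [[N [W [x [y [h1 [h2 h3] h4]]]]]|[W [N [x [y [[h1 h2] h3 h4]]]]]].
  by exists W, N, y, x.
by exists N, W, y, x.
Qed.

Lemma cminus_op (C : T) : @cminus (opext T) Y X C <-> cplus X Y C.
Proof.
split=> [[W [N [x [y [[h1 h2] h3 h4]]]]]|[N [W [x [y [h1 [h2 h3] h4]]]]]].
  by exists N, W, y, x.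
by exists W, N, y, x.
Qed.

Lemma heart_obj_op (C : T) : @heart_obj (opext T) Y X C <-> heart_obj X Y C.
Proof.
by split=> -[h1 h2]; split; [apply/cminus_op|apply/cplus_op|
  apply/cplus_op|apply/cminus_op].
Qed.

Lemma factors_op (A B : T) (f : hom A B) :
  @factors (opcat T) (inter Y X) B A f <-> factors (inter X Y) f.
Proof.
by split=> -[N [g [h [[h1 h2] ->]]]]; exists N, h, g.
Qed.

End CotorsionOp.

Section Cotorsion.

Variables (T : extri) (X Y : T -> Prop).
Hypothesis cXY : is_cotorsion_pair X Y.

Let bi := extri_biadditive (extriP T).

Lemma cot_lift (N W C U : T) (x : hom N W) (y : hom W C) (g : hom U C) :
  triangle x y -> Y N -> X U -> exists l : hom U W, y \co l = g.
Proof. by move=> [d r] YN XU; apply: (tri_lift r); apply: (cot_CP1 cXY). Qed.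

(** If E(M, Y) = 0, then the X-approximation of M splits, so M is a summand of
    an object of X. *)
Lemma cot_perp (M : T) : X M <-> forall N, Y N -> forall d : ext M N, d = 0.
Proof.
split=> [XM N YN d|M0]; first exact: (cot_CP1 cXY).
have [Y1 [X1 [x [y [YY1 XX1 [d r]]]]]] := cot_CP2l cXY M.
have [q qx] : exists q, q \co x = idm Y1.
  by apply: (tri_extend r); rewrite (M0 _ YY1 d) push_zero.
have [s [ys qs e]] := tri_retraction r qx.
pose P := Biproduct qx ys qs (tri_comp r) e.
by have [] := cot_sumX cXY (XX1 : X P).
Qed.

Lemma cot_retract (M W : T) (g : hom M W) (h : hom W M) :
  h \co g = idm M -> X W -> X M.
Proof.
move=> e XW; apply/cot_perp => N YN d.
rewrite -[d](pull1 bi) -e -pull_comp (cot_CP1 cXY XW YN (pull h d)).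
exact: pull_zero.
Qed.

Lemma cot_ext (A B C : T) (x : hom A B) (y : hom B C) :
  triangle x y -> X A -> X C -> X B.
Proof.
move=> [d r] XA XC; apply/cot_perp => N YN e.
have [|e' ->] := tri_ext_exact r (e := e); first exact: (cot_CP1 cXY).
by rewrite (cot_CP1 cXY XC YN e') pull_zero.
Qed.

End Cotorsion.

Lemma cot_extend (T : extri) (X Y : T -> Prop) (cXY : is_cotorsion_pair X Y)
    (N W C U : T) (x : hom C W) (y : hom W N) (g : hom C U) :
  triangle x y -> X N -> Y U -> exists l : hom W U, l \co x = g.
Proof. exact: (@cot_lift (opext T) Y X (cotorsion_op cXY) N W C U y x g). Qed.

Lemma cot_perpr (T : extri) (X Y : T -> Prop) (cXY : is_cotorsion_pair X Y) (M : T) :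
  Y M <-> forall N, X N -> forall d : ext N M, d = 0.
Proof. exact: (@cot_perp (opext T) Y X (cotorsion_op cXY)). Qed.

Lemma cot_retractr (T : extri) (X Y : T -> Prop) (cXY : is_cotorsion_pair X Y)
    (M W : T) (g : hom M W) (h : hom W M) :
  h \co g = idm M -> Y W -> Y M.
Proof. exact: (@cot_retract (opext T) Y X (cotorsion_op cXY) M W h g). Qed.

(** * Inflations with cone in X and deflations with fibre in Y *)

Definition inflation_in (T : extri) (U : T -> Prop) (A B : T) (f : hom A B) :
  Prop :=
  exists (N : T) (g : hom B N), U N /\ triangle f g.

Definition deflation_in (T : extri) (U : T -> Prop) (A B : T) (f : hom A B) :
  Prop :=
  exists (N : T) (g : hom N A), U N /\ triangle g f.

Section Heart.

Variables (T : extri) (X Y : T -> Prop).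
Hypothesis cXY : is_cotorsion_pair X Y.

Let W := inter X Y.
Let addT := extri_additive (extriP T).

Lemma factors0 (A B : T) : factors W (0 : hom A B).
Proof.
have [Z Z0 WZ] := subcat_zero (cot_subXY cXY).
by exists Z, 0, 0; rewrite comp0m.
Qed.

Lemma factorsD (A B : T) (f g : hom A B) :
  factors W f -> factors W g -> factors W (f + g).
Proof.
move=> /asboolP fW /asboolP gW; apply/asboolP.
have := rpredD (fW : f \in factor_zmod addT (cot_subXY cXY) A B) gW.
exact.
Qed.

Lemma factorsN (A B : T) (f : hom A B) : factors W f -> factors W (- f).
Proof.
by move=> [N [g [h [WN ->]]]]; exists N, g, (- h); rewrite compNm.
Qed.

Lemma factorsB (A B : T) (f g : hom A B) :
  factors W f -> factors W g -> factors W (f - g).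
Proof. by move=> fW /factorsN; apply: factorsD. Qed.

Lemma factors_compl (A B C : T) (g : hom B C) (f : hom A B) :
  factors W f -> factors W (g \co f).
Proof. by move=> [N [u [v [WN ->]]]]; exists N, u, (g \co v); rewrite compA. Qed.

Lemma factors_compr (A B C : T) (g : hom B C) (f : hom A B) :
  factors W g -> factors W (g \co f).
Proof. by move=> [N [u [v [WN ->]]]]; exists N, (u \co f), v; rewrite compA. Qed.

Lemma inflation_in_comp (A B C : T) (g : hom B C) (f : hom A B) :
  inflation_in X g -> inflation_in X f -> inflation_in X (g \co f).
Proof.
move=> [F [g' [XF [d2 r2]]]] [D [f' [XD [d1 r1]]]].
have [E [h' [d3 [d [e [r3 [_ [_ [r4 _]]]]]]]]] := extri_ET4 (extriP T) r1 r2.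
exists E, h'; split; last by exists d3.
exact: (cot_ext cXY (ex_intro _ (push f' d2) r4) XD XF).
Qed.

(** Embed C into Y1 in Y with cone in X; it suffices that E(Y1, V) = 0 for V in
    Y.  The composite B -> Y1 also has its cone in X, so a class in E(Y1, V) is
    zero as soon as its restriction to B is; and this restriction vanishes
    because B -> Y1 factors through an object of X. *)
Lemma cminus_cone (B C : T) (b : hom B C) :
  inflation_in X b -> cminus X Y B -> cminus X Y C.
Proof.
move=> ib [W0 [XB [w [q [[XW0 YW0] XXB tB]]]]].
have [Y1 [X2 [y [p [YY1 XX2 tC]]]]] := cot_CP2r cXY C.
have [N [n [XN [d r]]]] : inflation_in X (y \co b).
  by apply: inflation_in_comp ib; exists X2, p.
exists Y1, X2, y, p; split=> //; split=> //.
apply/(cot_perp cXY) => V YV e.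
have [|e' ->] := tri_ext_exact r (e := e).
  have [l lw] := cot_extend cXY (y \co b) tB XXB YY1.
  by rewrite -lw -pull_comp (cot_CP1 cXY XW0 YV (pull l e)) pull_zero.
by rewrite (cot_CP1 cXY XN YV e') pull_zero.
Qed.

(** If u b factors through W', then B -> W' extends to C since the cone is in X;
    the difference of u with the resulting map factors through the cone, hence
    through the given W1 -> M, whose fibre is in Y. *)
Lemma inflation_in_epi (B C M : T) (b : hom B C) (u : hom C M) :
  inflation_in X b -> cplus X Y M -> factors W (u \co b) -> factors W u.
Proof.
move=> [N [n [XN tb]]] [Y1 [W1 [x [y [YY1 WW1 tM]]]]] [W' [g [h [[XW' YW'] e]]]].
have [g' gb] := cot_extend cXY g tb XN YW'.
have [d r] := tb.
have [t tn] : exists t, t \co n = u - h \co g'.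
  by apply: (tri_coker r); rewrite compBl e -compA gb subrr.
have [l yl] := cot_lift cXY t tM YY1 XN.
rewrite -[u](subrK (h \co g')) -tn -yl; apply: factorsD.
  by exists W1, (l \co n), y; rewrite compA.
by exists W', g', h.
Qed.

End Heart.

Lemma cplus_fibre (T : extri) (X Y : T -> Prop) (cXY : is_cotorsion_pair X Y)
    (B C : T) (b : hom B C) :
  deflation_in Y b -> cplus X Y C -> cplus X Y B.
Proof.
move=> db /cminus_op pC; apply/cminus_op.
exact: (@cminus_cone (opext T) Y X (cotorsion_op cXY) C B b db pC).
Qed.

Section HeartCokernels.

Variables (T : extri) (X Y : T -> Prop).
Hypothesis cXY : is_cotorsion_pair X Y.

Let W := inter X Y.
Let bi := extri_biadditive (extriP T).

(** The reflection of C into B^+: push the X-approximation of C out along its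
    embedding into an object of X and Y.  A map from C to M in B^+, restricted
    to the approximation, lifts to the object of X and Y that covers M, and so
    extends to the embedding. *)
Lemma cplus_reflection (C : T) : exists (K : T) (k : hom C K),
  [/\ inflation_in X k, cplus X Y K &
      forall (M : T) (g : hom C M), cplus X Y M -> exists u : hom K M, u \co k = g].
Proof.
have [Y1 [X1 [x [y [YY1 XX1 [d1 r1]]]]]] := cot_CP2l cXY C.
have [W1 [X2 [w [p [YW1 XX2 [d2 r2]]]]]] := cot_CP2r cXY X1.
have XW1 : X W1 :=
  cot_ext cXY (ex_intro _ d2 r2) XX1 XX2.
have [K [h' [d3 [k [e [r3 [hk [eh [r4 _]]]]]]]]] := extri_ET4 (extriP T) r1 r2.
exists K, k; split.
- by exists X2, e; split=> //; exists (push y d2).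
- by exists Y1, W1, (w \co x), h'; split=> //; exists d3.
move=> M g [Y3 [W3 [m [n [YY3 [XW3 YW3] t3]]]]].
have [l nl] := cot_lift cXY (g \co y) t3 YY3 XX1.
have [l' lw] : exists l', l' \co w = l.
  exact: (cot_extend cXY _ (ex_intro _ d2 r2) XX2 YW3).
have [r [rk _]] : exists r : hom K M, r \co k = g /\ r \co h' = n \co l'.
  by apply: (weak_pushout r2 r4 (esym hk) eh); rewrite -compA lw nl.
by exists r.
Qed.

(** The cokernel of f in the heart: push an embedding of A into an object of
    X and Y out along f, and reflect the result into B^+. *)
Lemma heart_cokernel (A B : T) (f : hom A B) :
  cminus X Y A -> cminus X Y B ->
  exists (K : T) (k : hom B K),
    [/\ heart_obj X Y K, inflation_in X k, factors W (k \co f) &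
      forall (M : T) (g : hom B M), cplus X Y M -> factors W (g \co f) ->
        exists u : hom K M, u \co k = g].
Proof.
move=> [W1 [X1 [w [q [WW1 XX1 [d r]]]]]] mB.
have [C [x [y r']]] := realization_exists (push f d).
have [b [bw e]] : exists b, b \co w = x \co f /\ idm X1 \co q = y \co b.
  apply: (real_lift (extri_real (extriP T))) r r' _.
  by rewrite /ext_morphism (pull1 bi).
rewrite comp1m in e.
have [K [k [ik pK uK]]] := cplus_reflection C.
have ix : inflation_in X x by exists X1, y; split=> //; exists (push f d).
have ikx := inflation_in_comp cXY ik ix.
exists K, (k \co x); split=> //.
- by split=> //; exact: (cminus_cone cXY ikx mB).
- rewrite -compA -bw compA; apply: factors_compr.
  by exists W1, (idm W1), (k \co b); rewrite compm1.
move=> M g pM [W' [u [v [[XW' YW'] gf]]]].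
have [u' uw] : exists u', u' \co w = u :=
  cot_extend cXY _ (ex_intro _ d r) XX1 YW'.
have [r0 [rx _]] : exists r0, r0 \co x = g /\ r0 \co b = v \co u'.
  by apply: (weak_pushout r r' bw (esym e)); rewrite -compA uw.
have [m mk] := uK M r0 pM.
by exists m; rewrite compA mk.
Qed.

(** An inflation b with cone in X is the cokernel, in the heart, of D -> A
    obtained by pulling back a deflation W1 -> E with fibre in Y: the cone of
    D -> W1 is that of b, so maps from D to objects of Y extend to W1, and the
    weak pushout property applies. *)
Lemma inflation_in_cokernel (A E : T) (b : hom A E) :
  heart_obj X Y A -> heart_obj X Y E -> inflation_in X b ->
  exists (D : T) (d : hom D A), [/\ heart_obj X Y D, factors W (b \co d) &
    forall (M : T) (g : hom A M), factors W (g \co d) ->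
      exists u : hom E M, u \co b = g].
Proof.
move=> [pA mA] [[Y1 [W1 [x [y [YY1 [XW1 YW1] [d2 r2]]]]]] _].
move=> [X1 [q [XX1 [d1 r1]]]].
have [D [h [d3 [d [e [r3 [bd [_ [r4 [pd3 _]]]]]]]]]] := extri_ET4op (extriP T) r1 r2.
exists D, d; split.
- split.
    apply: (cplus_fibre cXY (b := d)) pA.
    by exists Y1, e; split=> //; exists (pull b d2).
  by exists W1, X1, h, (q \co y); split=> //; exists d3.
- by rewrite bd; exists W1, h, y.
move=> M g [W' [u [v [[XW' YW'] e']]]].
have [u' uh] : exists u', u' \co h = u :=
  cot_extend cXY _ (ex_intro _ d3 r3) XX1 YW'.
rewrite -pd3 in r1.
have [r [rb _]] : exists r, r \co b = g /\ r \co y = v \co u'.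
  by apply: (weak_pushout r3 r1 (esym bd)); rewrite // e' -compA uh.
by exists r.
Qed.

(** Monomorphisms and epimorphisms of the heart, expressed on representatives:
    in this form duality is visible before passing to the quotient. *)
Definition heart_mono (A B : T) (f : hom A B) : Prop :=
  forall (Z : T) (g : hom Z A), heart_obj X Y Z ->
    factors W (f \co g) -> factors W g.

Definition heart_epi (A B : T) (f : hom A B) : Prop :=
  forall (Z : T) (g : hom B Z), heart_obj X Y Z ->
    factors W (g \co f) -> factors W g.

(** The morphism D -> A of which b is the cokernel is zero in the heart, because
    b is mono, so the identity of A extends along b. *)
Lemma inflation_in_mono_split (A E : T) (b : hom A E) :
  heart_obj X Y A -> heart_obj X Y E -> inflation_in X b -> heart_mono b ->
  exists r : hom E A, r \co b = idm A /\ factors W (b \co r - idm E).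
Proof.
move=> hA hE ib mb; have [D [d [hD bd0 uni]]] := inflation_in_cokernel hA hE ib.
have [r rb] : exists r, r \co b = idm A.
  by apply: uni; rewrite comp1m; apply: mb.
exists r; split=> //; apply: (inflation_in_epi cXY ib hE.1).
by rewrite compBl -compA rb compm1 comp1m subrr; apply: factors0.
Qed.

End HeartCokernels.

(** * Hearts are abelian *)

Definition heart_is_kernel (T : extri) (X Y : T -> Prop) (K A B : T)
    (k : hom K A) (f : hom A B) : Prop :=
  [/\ heart_obj X Y K, factors (inter X Y) (f \co k), heart_mono X Y k &
    forall (M : T) (g : hom M A), heart_obj X Y M ->
      factors (inter X Y) (f \co g) ->
      exists u : hom M K, factors (inter X Y) (k \co u - g)].

Definition heart_is_cokernel (T : extri) (X Y : T -> Prop) (A B K : T)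
    (f : hom A B) (k : hom B K) : Prop :=
  [/\ heart_obj X Y K, factors (inter X Y) (k \co f), heart_epi X Y k &
    forall (M : T) (g : hom B M), heart_obj X Y M ->
      factors (inter X Y) (g \co f) ->
      exists u : hom K M, factors (inter X Y) (u \co k - g)].

Section HeartOp.

Variables (T : extri) (X Y : T -> Prop).

Lemma heart_mono_op (A B : T) (f : hom A B) :
  @heart_mono (opext T) Y X B A f <-> heart_epi X Y f.
Proof.
split=> h Z g /heart_obj_op hZ /factors_op fW.
  by apply/factors_op; apply: (h Z g hZ fW).
by apply/factors_op; apply: (h Z g hZ fW).
Qed.

Lemma heart_epi_op (A B : T) (f : hom A B) :
  @heart_epi (opext T) Y X B A f <-> heart_mono X Y f.
Proof.
split=> h Z g /heart_obj_op hZ /factors_op fW.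
  by apply/factors_op; apply: (h Z g hZ fW).
by apply/factors_op; apply: (h Z g hZ fW).
Qed.

Lemma heart_cokernel_op (A B K : T) (f : hom A B) (k : hom K A) :
  @heart_is_cokernel (opext T) Y X B A K f k -> heart_is_kernel X Y k f.
Proof.
move=> [/heart_obj_op hK /factors_op fk /heart_epi_op mk uk]; split=> //.
move=> M g /heart_obj_op hM /factors_op fg.
by have [u /factors_op uW] := uk M g hM fg; exists u.
Qed.

End HeartOp.

Section HeartExactness.

Variables (T : extri) (X Y : T -> Prop).
Hypothesis cXY : is_cotorsion_pair X Y.

Let W := inter X Y.
Let re := extri_real (extriP T).

Lemma deflation_in_epi_split (A E : T) (p : hom E A) :
  heart_obj X Y A -> heart_obj X Y E -> deflation_in Y p -> heart_epi X Y p ->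
  exists s : hom A E, p \co s = idm A /\ factors W (s \co p - idm E).
Proof.
move=> /heart_obj_op hA /heart_obj_op hE dp /heart_mono_op ep.
have [s [e sW]] :=
  @inflation_in_mono_split (opext T) Y X (cotorsion_op cXY) A E p hA hE dp ep.
by exists s; split=> //; apply/factors_op.
Qed.

Lemma heart_cokernel_exists (A B : T) (f : hom A B) :
  heart_obj X Y A -> heart_obj X Y B ->
  exists (K : T) (k : hom B K), heart_is_cokernel X Y f k.
Proof.
move=> hA hB; have [K [k [hK ik kf uk]]] := heart_cokernel cXY f hA.2 hB.2.
exists K, k; split=> //.
  by move=> Z g hZ; apply: (inflation_in_epi cXY ik hZ.1).
move=> M g hM gf; have [u uE] := uk M g hM.1 gf.
by exists u; rewrite uE subrr; apply: factors0.
Qed.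

Lemma heart_obj_sum (A W0 : T) (P : biproduct A W0) :
  heart_obj X Y A -> W W0 -> heart_obj X Y P.
Proof.
move=> [pA mA] [XW0 YW0]; split.
  apply: (cplus_fibre cXY (b := pr1 P)) pA.
  exists W0, (in2 P); split=> //; exists 0.
  exact: (real_zero re (biprod_swap P)).
apply: (cminus_cone cXY (b := in1 P)) mA.
by exists W0, (pr2 P); split=> //; exists 0; apply: (real_zero re P).
Qed.

(** An epimorphism f of the heart is isomorphic to a deflation f' from the sum
    of A and an object of X and Y.  Pushing the fibre C of f' into an object of
    Y factors f' as an inflation with cone in X, which is a cokernel, followed
    by a deflation with fibre in Y, which is epi and hence invertible. *)
Lemma heart_epi_cokernel (wic : WIC T) (A B : T) (f : hom A B) :
  heart_obj X Y A -> heart_obj X Y B -> heart_epi X Y f ->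
  exists (D : T) (d : hom D A), heart_obj X Y D /\ heart_is_cokernel X Y d f.
Proof.
move=> hA hB ef; have [Y0 [W0 [v [w [YY0 WW0 tB]]]]] := hB.1.
have [P] := (extri_additive (extriP T)).2 A W0.
have hP := heart_obj_sum P hA WW0.
pose f' : hom P B := f \co pr1 P + w \co pr2 P.
have f'1 : f' \co in1 P = f.
  by rewrite compDl -!compA pr1_in1 pr2_in1 compm0 addr0 compm1.
have f'2 : f' \co in2 P = w.
  by rewrite compDl -!compA pr1_in2 pr2_in2 compm0 add0r compm1.
have [C [c tc]] : deflation f'.
  by apply: (wic _ _ _ (in2 P) f').2; rewrite f'2; exists Y0, v.
have [Y1 [X1 [y [x [YY1 XX1 tC]]]]] := cot_CP2r cXY C.
have [M [p [e2 [m2 [q [tp tq pq]]]]]] := pushout_inflations tc tC.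
have dp : deflation_in Y p by exists Y1, e2.
have iq : inflation_in X q by exists X1, m2.
have hM : heart_obj X Y M.
  by split; [apply: (cplus_fibre cXY dp hB.1) | apply: (cminus_cone cXY iq hP.2)].
have ep : heart_epi X Y p.
  move=> Z g hZ gp; apply: ef hZ _.
  by rewrite -f'1 -pq 2!compA; do 2!apply: factors_compr.
have [s [ps sp]] := deflation_in_epi_split hB hM dp ep.
have [D [d [hD qd uq]]] := inflation_in_cokernel cXY hP hM iq.
exists D, (pr1 P \co d); split=> //; split=> //.
  have -> : f \co (pr1 P \co d) = p \co (q \co d) - w \co (pr2 P \co d).
    by rewrite !compA pq compDl addrK.
  apply: (factorsB cXY); first exact: factors_compl.
  by exists W0, (pr2 P \co d), w.
move=> N g hN; rewrite compA => gd.
have [u uE] := uq N (g \co pr1 P) gd.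
exists (u \co s).
have -> : u \co s \co f - g = u \co (s \co p - idm M) \co (q \co in1 P).
  rewrite -f'1 -pq compBr compm1 compBl !compA uE.
  by rewrite -(compA g) pr1_in1 compm1.
by apply: factors_compr; apply: factors_compl.
Qed.

End HeartExactness.

Section HeartAbelian.

Variables (T : extri) (X Y : T -> Prop).
Hypothesis cXY : is_cotorsion_pair X Y.

Let W := inter X Y.
Let re := extri_real (extriP T).
Let addT := extri_additive (extriP T).
Let Q := heart cXY.

Lemma heart_kernel_exists (A B : T) (f : hom A B) :
  heart_obj X Y A -> heart_obj X Y B ->
  exists (K : T) (k : hom K A), heart_is_kernel X Y k f.
Proof.
move=> /heart_obj_op hA /heart_obj_op hB.
have [K [k hk]] :=
  @heart_cokernel_exists (opext T) Y X (cotorsion_op cXY) B A f hB hA.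
by exists K, k; apply: heart_cokernel_op.
Qed.

Lemma WIC_op : WIC T -> WIC (opext T).
Proof.
move=> wic A B C f g.
by split; [apply: (wic C B A g f).2 | apply: (wic C B A g f).1].
Qed.

Lemma heart_mono_kernel (wic : WIC T) (A B : T) (f : hom A B) :
  heart_obj X Y A -> heart_obj X Y B -> heart_mono X Y f ->
  exists (D : T) (d : hom B D), heart_obj X Y D /\ heart_is_kernel X Y f d.
Proof.
move=> /heart_obj_op hA /heart_obj_op hB /heart_epi_op mf.
have [D [d [/heart_obj_op hD hk]]] := @heart_epi_cokernel (opext T) Y X
  (cotorsion_op cXY) (WIC_op wic) B A f hB hA mf.
by exists D, d; split=> //; apply: heart_cokernel_op.
Qed.

Definition heart_pi (M N : Q) (f : hom (sval M) (sval N)) : hom M N :=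
  quot_pi addT (cot_subXY cXY) f.

Lemma heart_pi_surj (M N : Q) (f : hom M N) : exists g, f = heart_pi g.
Proof. by exists (quot_repr f); rewrite /heart_pi quot_reprK. Qed.

Lemma heart_pi_comp (M N L : Q) (g : hom (sval N) (sval L))
    (f : hom (sval M) (sval N)) :
  heart_pi g \co heart_pi f = heart_pi (g \co f).
Proof. exact: quot_compE. Qed.

Lemma heart_pi1 (M : Q) : heart_pi (idm (sval M)) = idm M.
Proof. by []. Qed.

Lemma heart_piP (M N : Q) (f g : hom (sval M) (sval N)) :
  heart_pi f = heart_pi g <-> factors W (f - g).
Proof. exact: quot_piP. Qed.

Lemma heart_piD (M N : Q) (f g : hom (sval M) (sval N)) :
  heart_pi (f + g) = heart_pi f + heart_pi g.
Proof. exact: quot_piD. Qed.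

Lemma heart_pi_zero (M N : Q) : heart_pi (0 : hom (sval M) (sval N)) = 0.
Proof. by apply: (@addrI _ (heart_pi 0)); rewrite -heart_piD !addr0. Qed.

Lemma heart_pi0 (M N : Q) (f : hom (sval M) (sval N)) :
  heart_pi f = 0 <-> factors W f.
Proof.
by rewrite -heart_pi_zero; split=> [/heart_piP|fW]; [|apply/heart_piP];
  rewrite subr0.
Qed.

Lemma heart_pi_mono (M N : Q) (f : hom (sval M) (sval N)) :
  heart_mono X Y f -> is_mono (heart_pi f).
Proof.
move=> mf Z g h; have [g' ->] := heart_pi_surj g; have [h' ->] := heart_pi_surj h.
rewrite !heart_pi_comp => /heart_piP; rewrite -compBr => fW.
exact/heart_piP/mf/fW/(svalP Z).
Qed.

Lemma heart_pi_epi (M N : Q) (f : hom (sval M) (sval N)) :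
  heart_epi X Y f -> is_epi (heart_pi f).
Proof.
move=> mf Z g h; have [g' ->] := heart_pi_surj g; have [h' ->] := heart_pi_surj h.
rewrite !heart_pi_comp => /heart_piP; rewrite -compBl => fW.
exact/heart_piP/mf/fW/(svalP Z).
Qed.

Lemma mono_heart_mono (M N : Q) (f : hom (sval M) (sval N)) :
  is_mono (heart_pi f) -> heart_mono X Y f.
Proof.
move=> mf Z g hZ fg; pose Z' : Q := exist _ Z hZ.
apply/(@heart_pi0 Z' M)/mf; rewrite (heart_pi_comp (M := Z')) compm0.
exact/(@heart_pi0 Z' N).
Qed.

Lemma epi_heart_epi (M N : Q) (f : hom (sval M) (sval N)) :
  is_epi (heart_pi f) -> heart_epi X Y f.
Proof.
move=> mf Z g hZ fg; pose Z' : Q := exist _ Z hZ.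
apply/(@heart_pi0 N Z')/mf; rewrite (heart_pi_comp (L := Z')) comp0m.
exact/(@heart_pi0 M Z').
Qed.

Lemma heart_pi_kernel (K M N : Q) (k : hom (sval K) (sval M))
    (f : hom (sval M) (sval N)) :
  heart_is_kernel X Y k f -> is_kernel (heart_pi k) (heart_pi f).
Proof.
move=> [_ fk mk uk]; split; first by rewrite heart_pi_comp; apply/heart_pi0.
move=> Z g; have [g' ->] := heart_pi_surj g.
rewrite heart_pi_comp => /heart_pi0 /(uk _ _ (svalP Z)) [u /heart_piP kuE].
exists (heart_pi u); split; first by rewrite heart_pi_comp.
by move=> u' e; apply: (heart_pi_mono mk); rewrite heart_pi_comp kuE.
Qed.

Lemma heart_pi_cokernel (K M N : Q) (k : hom (sval N) (sval K))
    (f : hom (sval M) (sval N)) :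
  heart_is_cokernel X Y f k -> is_cokernel (heart_pi f) (heart_pi k).
Proof.
move=> [_ fk mk uk]; split; first by rewrite heart_pi_comp; apply/heart_pi0.
move=> Z g; have [g' ->] := heart_pi_surj g.
rewrite heart_pi_comp => /heart_pi0 /(uk _ _ (svalP Z)) [u /heart_piP kuE].
exists (heart_pi u); split; first by rewrite heart_pi_comp.
by move=> u' e; apply: (heart_pi_epi mk); rewrite heart_pi_comp kuE.
Qed.

Lemma heart_obj_biproduct (M N : T) (P : biproduct M N) :
  heart_obj X Y M -> heart_obj X Y N -> heart_obj X Y P.
Proof.
have sX := cot_subX cXY; have sY := cot_subY cXY.
move=> [[N1 [W1 [x1 [y1 [h1 [h2 h3] [d1 r1]]]]]]
  [W2 [N2 [x2 [y2 [[h4 h5] h6 [d2 r2]]]]]]].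
move=> [[N3 [W3 [x3 [y3 [h7 [h8 h9] [d3 r3]]]]]]
  [W4 [N4 [x4 [y4 [[h10 h11] h12 [d4 r4]]]]]]].
have [P1] := addT.2 N1 N3; have [P2] := addT.2 W1 W3.
have [P3] := addT.2 N2 N4; have [P4] := addT.2 W2 W4.
split.
  exists P1, P2, (bimap P1 P2 x1 x3), (bimap P2 P y1 y3); split.
  - exact: subcat_sum sY _ _ P1 h1 h7.
  - by split; [apply: subcat_sum sX _ _ P2 h2 h8 | apply: subcat_sum sY _ _ P2 h3 h9].
  - by exists (ext_sum P P1 d1 d3); apply: (real_sum re).
exists P4, P3, (bimap P P4 x2 x4), (bimap P4 P3 y2 y4); split.
- by split; [apply: subcat_sum sX _ _ P4 h4 h10 | apply: subcat_sum sY _ _ P4 h5 h11].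
- exact: subcat_sum sX _ _ P3 h6 h12.
- by exists (ext_sum P3 P d2 d4); apply: (real_sum re).
Qed.

Lemma heart_additive : is_additive Q.
Proof.
split.
  have [Z Z0 [XZ YZ]] := subcat_zero (cot_subXY cXY).
  have [P] := addT.2 Z Z.
  have WP : W P by split; [apply: subcat_sum (cot_subX cXY) _ _ P _ _ |
    apply: subcat_sum (cot_subY cXY) _ _ P _ _].
  have tP : triangle (in1 P) (pr2 P) by exists 0; apply: (real_zero re).
  have hZ : heart_obj X Y Z.
    by split; [exists Z, P, (in1 P), (pr2 P) | exists P, Z, (in1 P), (pr2 P)].
  exists (exist _ Z hZ); apply/(@heart_pi0 (exist _ Z hZ) (exist _ Z hZ) (idm Z)).
  by rewrite Z0; apply: factors0.
move=> M N; have [P] := addT.2 (sval M) (sval N).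
pose P' : Q := exist _ (P : T) (heart_obj_biproduct P (svalP M) (svalP N)).
constructor; apply: (@Biproduct Q M N P' (@heart_pi M P' (in1 P))
  (@heart_pi N P' (in2 P))
  (@heart_pi P' M (pr1 P)) (@heart_pi P' N (pr2 P))); rewrite !heart_pi_comp.
- by rewrite pr1_in1.
- by rewrite pr2_in2.
- by rewrite pr1_in2 heart_pi_zero.
- by rewrite pr2_in1 heart_pi_zero.
- by rewrite -heart_piD bp_sum.
Qed.

Theorem heart_abelian : WIC T -> is_abelian Q.
Proof.
move=> wic; split; first exact: heart_additive.
- move=> M N f; have [f' ->] := heart_pi_surj f.
  have [K [k hk]] := heart_kernel_exists f' (svalP M) (svalP N).
  have [hK _ _ _] := hk; exists (exist _ K hK), (@heart_pi (exist _ K hK) M k).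
  exact: heart_pi_kernel.
- move=> M N f; have [f' ->] := heart_pi_surj f.
  have [K [k hk]] := heart_cokernel_exists cXY f' (svalP M) (svalP N).
  have [hK _ _ _] := hk; exists (exist _ K hK), (@heart_pi N (exist _ K hK) k).
  exact: heart_pi_cokernel.
- move=> M N f; have [f' ->] := heart_pi_surj f => /mono_heart_mono mf.
  have [D [d [hD hk]]] := heart_mono_kernel wic (svalP M) (svalP N) mf.
  by exists (exist _ D hD), (@heart_pi N (exist _ D hD) d); apply: heart_pi_kernel.
- move=> M N f; have [f' ->] := heart_pi_surj f => /epi_heart_epi mf.
  have [D [d [hD hk]]] := heart_epi_cokernel cXY wic (svalP M) (svalP N) mf.
  by exists (exist _ D hD), (@heart_pi (exist _ D hD) M d); apply: heart_pi_cokernel.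
Qed.

Lemma heart_pi_iso (M N : Q) (f : hom (sval M) (sval N)) :
  is_iso f -> is_iso (heart_pi f).
Proof. by move=> [g [e1 e2]]; exists (heart_pi g); rewrite !heart_pi_comp e1 e2. Qed.

End HeartAbelian.

(** * Adjoint functors *)

Definition opfun (C D : preaddCat) (F : functor C D) :
  functor (opcat C) (opcat D) :=
  @Functor (opcat C) (opcat D) (fobj F) (fun A B => @fmor C D F B A)
    (fmor1 F) (fun A B E g f => fmorM F f g) (fun A B => @fmorD C D F B A).

Definition adj_op (C D : preaddCat) (F : functor C D) (G : functor D C)
    (h : adjunction F G) : adjunction (opfun G) (opfun F) :=
  @Adjunction (opcat D) (opcat C) (opfun G) (opfun F)
    (adj_counit h) (adj_unit h)
    (fun A A' f => esym (counit_nat h f)) (fun B B' f => esym (unit_nat h f))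
    (unit_counit h) (counit_unit h).

Section Functors.

Variables (C D : preaddCat) (F : functor C D).

Lemma fmor0 (A B : C) : fmor F (0 : hom A B) = 0.
Proof. by apply: (@addrI _ (fmor F 0)); rewrite -fmorD !addr0. Qed.

Lemma fmor_zero (A : C) : is_zero A -> is_zero (F A).
Proof. by move=> A0; rewrite /is_zero -fmor1 A0 fmor0. Qed.

Lemma fmor_iso (A B : C) (f : hom A B) : is_iso f -> is_iso (fmor F f).
Proof. by move=> [g [e1 e2]]; exists (fmor F g); rewrite -!fmorM e1 e2 !fmor1. Qed.

Lemma fobj_iso (A B : C) : isomorphic A B -> isomorphic (F A) (F B).
Proof. by move=> [f fi]; exists (fmor F f); apply: fmor_iso. Qed.

Lemma ff_op : fully_faithful F -> fully_faithful (opfun F).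
Proof. by move=> ff A B; apply: ff. Qed.

End Functors.

Lemma zero_iso (C : preaddCat) (A B : C) : isomorphic A B -> is_zero A -> is_zero B.
Proof.
by move=> [f [g [_ fg]]] A0; rewrite /is_zero -fg (zero_target g A0) compm0.
Qed.

Lemma iso_cancell (C : preaddCat) (A B : C) (f : hom A B) (g : hom B A) :
  is_iso f -> g \co f = idm A -> is_iso g.
Proof.
move=> [f' [e1 e2]] gf; exists f; split=> //.
have -> : g = f' by rewrite -[g]compm1 -e2 compA gf comp1m.
by rewrite e2.
Qed.

Section Adjunctions.

Variables (C D : preaddCat) (F : functor C D) (G : functor D C).
Variable h : adjunction F G.

Lemma adj_inj (A : C) (B : D) (f g : hom (F A) B) :
  fmor G f \co adj_unit h A = fmor G g \co adj_unit h A -> f = g.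
Proof.
have K (k : hom (F A) B) :
    k = adj_counit h B \co fmor F (fmor G k \co adj_unit h A).
  by rewrite fmorM compA counit_nat -compA counit_unit compm1.
by move=> e; rewrite (K f) (K g) e.
Qed.

Lemma adj_zero (A : C) (B : D) (f : hom (F A) B) : is_zero (G B) -> f = 0.
Proof.
move=> GB0; apply: adj_inj.
by rewrite [LHS](zero_target _ GB0) [RHS](zero_target _ GB0).
Qed.

(** The inverse of the unit is the preimage under F of the counit at F A. *)
Lemma ff_unit_iso (A : C) : fully_faithful F -> is_iso (adj_unit h A).
Proof.
move=> /(_ _ A) ff; have [psi fpsi psif] := ff (G (F A)).
have Fe := psif (adj_counit h (F A)); set e := psi _ in Fe.
exists e; split.
  have [phi phiK _] : bijective (@fmor C D F A A) by [].
  by rewrite -[LHS]phiK -[RHS]phiK fmorM Fe counit_unit fmor1.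
by rewrite unit_nat Fe unit_counit.
Qed.

Lemma unit_iso_ff : (forall A, is_iso (adj_unit h A)) -> fully_faithful F.
Proof.
move=> ui A B; have [v [v1 v2]] := ui B.
exists (fun f => v \co fmor G f \co adj_unit h A) => f.
  by rewrite -compA -unit_nat compA v1 comp1m.
have Fv : fmor F v = adj_counit h (F B).
  by rewrite -[LHS]comp1m -(counit_unit h) -compA -fmorM v2 fmor1 compm1.
by rewrite !fmorM Fv counit_nat -compA counit_unit compm1.
Qed.

Lemma unit_iso_counitF (A : C) : is_iso (adj_unit h A) -> is_iso (adj_counit h (F A)).
Proof. by move=> /(fmor_iso F) /iso_cancell; apply; apply: counit_unit. Qed.

Lemma unit_iso_Gcounit (B : D) :
  is_iso (adj_unit h (G B)) -> is_iso (fmor G (adj_counit h B)).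
Proof. by move=> /iso_cancell; apply; apply: unit_counit. Qed.

Lemma left_adjoint_epi (A B : C) (f : hom A B) : is_epi f -> is_epi (fmor F f).
Proof.
move=> ef Z u v /(congr1 (fun k => fmor G k \co adj_unit h A)).
rewrite !fmorM -!compA -unit_nat !compA => /ef; exact: adj_inj.
Qed.

End Adjunctions.

Section CoAdjunctions.

Variables (C D : preaddCat) (F : functor C D) (G : functor D C).
Variable h : adjunction F G.

Lemma ff_counit_iso (B : D) : fully_faithful G -> is_iso (adj_counit h B).
Proof. by move=> /ff_op ff; apply/is_iso_op; apply: (ff_unit_iso (adj_op h) B ff). Qed.

Lemma counit_iso_ff : (forall B, is_iso (adj_counit h B)) -> fully_faithful G.
Proof.
move=> ci; have ff : fully_faithful (opfun G).
  by apply: (unit_iso_ff (h := adj_op h)) => B; apply/is_iso_op/ci.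
by move=> A B; apply: (ff B A).
Qed.

Lemma counit_iso_unitG (B : D) :
  is_iso (adj_counit h B) -> is_iso (adj_unit h (G B)).
Proof.
move=> /is_iso_op ci; apply/is_iso_op.
exact: (unit_iso_counitF (h := adj_op h) ci).
Qed.

End CoAdjunctions.

Definition preserves_triangles (T T' : extri) (F : functor T T') : Prop :=
  forall (A B C : T) (x : hom A B) (y : hom B C),
    triangle x y -> triangle (fmor F x) (fmor F y).

Lemma exact_triangles (T T' : extri) (F : functor T T') :
  is_exact F -> preserves_triangles F.
Proof. by move=> [_ [t ht]] A B C x y [d r]; exists (t C A d); apply: ht. Qed.

Lemma preserves_triangles_op (T T' : extri) (F : functor T T') :
  preserves_triangles F -> @preserves_triangles (opext T) (opext T') (opfun F).
Proof. by move=> pF A B C x y t; apply: (pF C B A y x t). Qed.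

(** Realize d by B -> M -> F A.  As E(A, G B) = 0, the unit A -> G F A lifts to
    G M, and the adjunct F A -> M of the lift is a section. *)
Lemma adj_ext_left (T T' : extri) (F : functor T T') (G : functor T' T)
    (h : adjunction F G) (A : T) (B : T') :
  preserves_triangles G -> (forall d : ext A (G B), d = 0) ->
  forall d : ext (F A) B, d = 0.
Proof.
move=> pG E0 d; have [M [x [y r]]] := realization_exists d.
have [d' r'] := pG _ _ _ _ _ (ex_intro _ d r).
have [s ys] := tri_lift r' (E0 (pull (adj_unit h A) d')).
apply: (tri_section r (s := adj_counit h M \co fmor F s)).
by rewrite compA -counit_nat -compA -fmorM ys counit_unit.
Qed.

Lemma adj_ext_right (T T' : extri) (F : functor T T') (G : functor T' T)
    (h : adjunction F G) (A : T) (B : T') :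
  preserves_triangles F -> (forall d : ext (F A) B, d = 0) ->
  forall d : ext A (G B), d = 0.
Proof.
move=> /preserves_triangles_op pF.
exact: (@adj_ext_left (opext T') (opext T) (opfun G) (opfun F) (adj_op h) B A pF).
Qed.

(** * Triangles with a vanishing term *)

Section ZeroTerms.

Variable T : extri.
Implicit Types A B C : T.

Let bi := extri_biadditive (extriP T).

Lemma triangle_iso_zero A B C (x : hom A B) (y : hom B C) :
  triangle x y -> is_iso x -> is_zero C.
Proof.
move=> [d r] [x' [x'x xx']].
have [s [ys _ _]] := tri_retraction r x'x.
by rewrite /is_zero -ys -[y]compm1 -xx' compA (tri_comp r) !comp0m.
Qed.

Lemma triangle_zero_iso A B C (x : hom A B) (y : hom B C) :
  triangle x y -> is_zero C -> is_iso x.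
Proof.
move=> [d r] C0.
have [x' x'x] : exists x', x' \co x = idm A.
  apply: (tri_extend r).
  by rewrite (push1 bi) -[d](pull1 bi) C0 zero_pull.
have [s [_ _ e]] := tri_retraction r x'x.
exists x'; split=> //.
by rewrite -e (zero_source s C0) comp0m addr0.
Qed.

End ZeroTerms.

Lemma triangle_zero_fibre (T : extri) (A B C : T) (x : hom A B) (y : hom B C) :
  triangle x y -> is_zero B -> is_zero C -> is_zero A.
Proof.
move=> t B0 C0.
apply: (@triangle_iso_zero (opext T) C B A y x t).
exact/is_iso_op/iso_zero_zero.
Qed.

(** * Exactness of the functors of a recollement *)

(** Used with L = i_*, G = i^! and P = j_* j^* M.  The cone K of the counit is
    killed by G because G maps the counit to an isomorphism; then G L N = 0 as
    well, so N = 0 and K = P. *)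
Lemma left_exact_seq4_triangle (A B : extri) (L : functor A B) (G : functor B A)
    (h : adjunction L G) (M P : B) (u : hom M P) (N : A) (v : hom P (L N)) :
  (forall N', is_iso (adj_unit h N')) -> preserves_triangles G -> is_zero (G P) ->
  left_exact_seq4 (adj_counit h M) u v -> triangle (adj_counit h M) u.
Proof.
move=> ui pG GP0 [K [g1 [g2 [t1 t2 -> _]]]].
have GK0 := triangle_iso_zero (pG _ _ _ _ _ t1) (unit_iso_Gcounit (ui _)).
have GLN0 := triangle_iso_zero (pG _ _ _ _ _ t2) (iso_zero_zero _ GK0 GP0).
have N0 : is_zero N := zero_iso (isomorphic_sym (ex_intro _ _ (ui N))) GLN0.
exact: triangle_isor t1 (triangle_zero_iso t2 (fmor_zero L N0)).
Qed.

Lemma right_exact_seq4_triangle (A B : extri) (L : functor A B) (G : functor B A)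
    (h : adjunction G L) (M P : B) (u : hom P M) (N : A) (v : hom (L N) P) :
  (forall N', is_iso (adj_counit h N')) -> preserves_triangles G -> is_zero (G P) ->
  right_exact_seq4 v u (adj_unit h M) -> triangle u (adj_unit h M).
Proof.
move=> ci /preserves_triangles_op pG GP0 [K [g1 [g2 [t1 t2 e cg]]]].
apply: (@left_exact_seq4_triangle (opext A) (opext B) (opfun L) (opfun G)
  (adj_op h) M P u N v _ pG GP0).
  by move=> N'; apply/is_iso_op/ci.
exists K, g2, g1; split=> // i d; exact/is_iso_op/cg.
Qed.

(** Used with F = j_!, G = j^* and I = i^*.  Right exactness of F compares F M
    with the fibre K of F N -> F P by a compatible deflation h1.  The image of
    h1 under G is also an inflation, by WIC, hence an isomorphism; and K is in
    the image of F since I kills it, so h1 itself is an isomorphism. *)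
Lemma left_adjoint_triangles (A B C : extri) (F : functor C B) (G : functor B C)
    (h : adjunction F G) (I : functor B A) :
  WIC C -> (forall M, is_iso (adj_unit h M)) ->
  preserves_compatible G -> preserves_triangles G ->
  preserves_triangles I -> (forall M, is_zero (I (F M))) ->
  (forall M, is_zero (I M) -> is_iso (adj_counit h M)) ->
  (forall (M N P : C) (f : hom M N) (g : hom N P), triangle f g ->
     right_exact_seq (fmor F f) (fmor F g)) ->
  preserves_triangles F.
Proof.
move=> wic ui cG pG pI IF0 ci rF M N P f g t.
have [K [h1 [x [tx ch1 [K' [k tk]] e]]]] := rF _ _ _ _ _ t.
have IK0 := triangle_zero_fibre (pI _ _ _ _ _ tx) (IF0 _) (IF0 _).
have iGh1 : is_iso (fmor G h1).
  apply: cG ch1 _ _; last by exists (G K'), (fmor G k); apply: pG.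
  apply: (wic _ _ _ (fmor G h1) (fmor G x)).1.
  rewrite -fmorM -e.
  have [v [v1 v2]] := ui M.
  have [w [w1 w2]] := ui N.
  have -> : fmor G (fmor F f) = (adj_unit h N \co f) \co v.
    by rewrite unit_nat -compA v2 compm1.
  exists P, (g \co w).
  apply: triangle_isol; last by exists (adj_unit h M).
  exact: triangle_isom.
have ih1 : is_iso h1.
  have [c [c1 c2]] := unit_iso_counitF (ui M).
  have -> : h1 = (adj_counit h K \co fmor F (fmor G h1)) \co c.
    by rewrite counit_nat -compA c2 compm1.
  apply: iso_comp; last by exists (adj_counit h (F M)).
  by apply: iso_comp (ci _ IK0) (fmor_iso F iGh1).
by rewrite e; apply: triangle_isol.
Qed.

Lemma compatible_op (T : extri) (A B : T) (f : hom A B) :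
  @compatible (opext T) B A f <-> compatible f.
Proof. by split=> c i d; apply/is_iso_op/c. Qed.

Lemma right_adjoint_triangles (A B C : extri) (F : functor C B) (G : functor B C)
    (h : adjunction G F) (I : functor B A) :
  WIC C -> (forall M, is_iso (adj_counit h M)) ->
  preserves_compatible G -> preserves_triangles G ->
  preserves_triangles I -> (forall M, is_zero (I (F M))) ->
  (forall M, is_zero (I M) -> is_iso (adj_unit h M)) ->
  (forall (M N P : C) (f : hom M N) (g : hom N P), triangle f g ->
     left_exact_seq (fmor F f) (fmor F g)) ->
  preserves_triangles F.
Proof.
move=> wic ci cG /preserves_triangles_op pG /preserves_triangles_op pI
  IF0 ui lF M N P f g t.
apply: (@left_adjoint_triangles (opext A) (opext B) (opext C)
  (opfun F) (opfun G)
  (adj_op h) (opfun I) (WIC_op wic) _ _ pG pI IF0 _ _ P N M g f t).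
- by move=> M'; apply/is_iso_op/ci.
- by move=> M' N' f' /compatible_op cf; apply/compatible_op/cG.
- by move=> M' IM0; apply/is_iso_op/ui.
move=> M' N' P' f' g' t'.
have [K [h1 [h2 [tK ch1 ih1 e]]]] := lF _ _ _ _ _ t'.
by exists K, h1, h2; split=> //; apply/compatible_op.
Qed.

(** * Transfer of cotorsion pairs and hearts *)

Section Transfer.

Variables (B D : extri) (p : functor B D) (s : functor D B) (ps : adjunction p s).
Hypotheses (pp : preserves_triangles p) (pos : preserves_triangles s).
Hypothesis ci : forall N, is_iso (adj_counit ps N).
Variables (X Y : B -> Prop) (X' Y' : D -> Prop).
Hypothesis cXY : is_cotorsion_pair X Y.
Hypotheses (X'E : forall N, X' N <-> X (s N)) (Y'E : forall N, Y' N <-> Y (s N)).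
Hypotheses (Xp : forall M, X M -> X' (p M)) (Yp : forall M, Y M -> Y' (p M)).

Definition fmor_biproduct (M N : D) (P : biproduct M N) : biproduct (s M) (s N).
Proof.
apply: (@Biproduct B (s M) (s N) (s P) (fmor s (in1 P)) (fmor s (in2 P))
  (fmor s (pr1 P)) (fmor s (pr2 P))); rewrite -!fmorM.
- by rewrite pr1_in1 fmor1.
- by rewrite pr2_in2 fmor1.
- by rewrite pr1_in2 fmor0.
- by rewrite pr2_in1 fmor0.
- by rewrite -fmorD bp_sum fmor1.
Defined.

Lemma subcat_preimage (U : B -> Prop) (U' : D -> Prop) :
  is_subcat U -> (forall N, U' N <-> U (s N)) -> is_subcat U'.
Proof.
move=> [ui [Z Z0 UZ] us] U'E; split.
- by move=> M N iMN /U'E UM; apply/U'E; apply: ui UM; apply: fobj_iso.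
- have pZ0 := fmor_zero p Z0; exists (p Z) => //; apply/U'E; apply: ui UZ.
  by exists 0; apply: iso_zero_zero => //; apply: fmor_zero.
- by move=> M N P /U'E UM /U'E UN; apply/U'E; apply: (us _ _ (fmor_biproduct P)).
Qed.

(** Approximations in D are the images under p of approximations of s N, and
    E(N, N') is isomorphic to E(p s N, N'), which vanishes with E(s N, s N'). *)
Lemma cotorsion_transfer : is_cotorsion_pair X' Y'.
Proof.
have [sX sY mX mY _ cl cr] := cXY; split.
- exact: subcat_preimage sX X'E.
- exact: subcat_preimage sY Y'E.
- by move=> M N P /X'E XP; have [] := mX _ _ (fmor_biproduct P) XP;
    split; apply/X'E.
- by move=> M N P /Y'E YP; have [] := mY _ _ (fmor_biproduct P) YP;
    split; apply/Y'E.
- move=> M N /X'E XM /Y'E YN d.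
  have bi := extri_biadditive (extriP D).
  have e0 : pull (adj_counit ps M) d = 0.
    by apply: (adj_ext_left ps pos) => d'; apply: (cot_CP1 cXY).
  have [c [_ c2]] := ci M.
  by rewrite -[d](pull1 bi) -c2 -pull_comp e0 pull_zero.
- move=> N; have [Y1 [X1 [x [y [YY1 XX1 t]]]]] := cl (s N).
  exists (p Y1), (p X1), (fmor p x), (adj_counit ps N \co fmor p y); split.
  + exact: Yp.
  + exact: Xp.
  + by apply: triangle_isor; first exact: pp.
move=> N; have [Y1 [X1 [x [y [YY1 XX1 t]]]]] := cr (s N).
have [c [c1 c2]] := ci N.
exists (p Y1), (p X1), (fmor p x \co c), (fmor p y); split.
- exact: Yp.
- exact: Xp.
- by apply: triangle_isol; [exact: pp | exists (adj_counit ps N)].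
Qed.

End Transfer.

Lemma descends_preserve (T T' : extri) (F : functor T T')
    (X Y : T -> Prop) (X' Y' : T' -> Prop) :
  preserves_triangles F -> (forall M, X M -> X' (F M)) ->
  (forall M, Y M -> Y' (F M)) -> descends_to_hearts F X Y X' Y'.
Proof.
move=> pF FX FY; split=> [M [pM mM]|M N f _ _ [W [g [k [[XW YW] ->]]]]]; last first.
  by exists (F W), (fmor F g), (fmor F k); rewrite fmorM; split=> //; split; auto.
split.
  have [N [W [x [y [YN [XW YW] t]]]]] := pM.
  exists (F N), (F W), (fmor F x), (fmor F y); split; auto.
  by split; auto.
have [W [N [x [y [[XW YW] XN t]]]]] := mM.
exists (F W), (F N), (fmor F x), (fmor F y); split; auto.
by split; auto.
Qed.

Lemma heart_functorE (T T' : extri) (F : functor T T')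
    (X Y : T -> Prop) (X' Y' : T' -> Prop)
    (c : is_cotorsion_pair X Y) (c' : is_cotorsion_pair X' Y')
    (dF : descends_to_hearts F X Y X' Y') (M N : heart c)
    (f : hom (sval M) (sval N)) :
  fmor (heart_functor c c' dF) (heart_pi f) =
  @heart_pi _ _ _ c' (heart_functor c c' dF M) (heart_functor c c' dF N) (fmor F f).
Proof. exact: quot_fmorE. Qed.

Section HeartAdjunction.

Variables (T T' : extri) (F : functor T T') (G : functor T' T) (h : adjunction F G).
Variables (X Y : T -> Prop) (X' Y' : T' -> Prop).
Hypotheses (c : is_cotorsion_pair X Y) (c' : is_cotorsion_pair X' Y').
Hypotheses (dF : descends_to_hearts F X Y X' Y') (dG : descends_to_hearts G X' Y' X Y).

Let hF := heart_functor c c' dF.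
Let hG := heart_functor c' c dG.

Definition heart_unit (M : heart c) : hom M (hG (hF M)) :=
  @heart_pi _ _ _ c M (hG (hF M)) (adj_unit h (sval M)).

Definition heart_counit (N : heart c') : hom (hF (hG N)) N :=
  @heart_pi _ _ _ c' (hF (hG N)) N (adj_counit h (sval N)).

Definition heart_adjunction : adjunction hF hG.
Proof.
apply: (@Adjunction _ _ hF hG heart_unit heart_counit).
- move=> M N f; have [g ->] := heart_pi_surj f.
  rewrite /heart_unit (heart_functorE c' dF g) (heart_functorE c dG) !heart_pi_comp.
  by rewrite unit_nat.
- move=> M N f; have [g ->] := heart_pi_surj f.
  rewrite /heart_counit (heart_functorE c dG g) (heart_functorE c' dF) !heart_pi_comp.
  by rewrite counit_nat.
- move=> M; rewrite /heart_unit (heart_functorE c' dF) /heart_counit heart_pi_comp.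
  by rewrite counit_unit heart_pi1.
- move=> M; rewrite /heart_counit (heart_functorE c dG) /heart_unit heart_pi_comp.
  by rewrite unit_counit heart_pi1.
Defined.

End HeartAdjunction.

Lemma abelian_mono_epi_iso (Q : preaddCat) (M N : Q) (f : hom M N) :
  is_abelian Q -> is_mono f -> is_epi f -> is_iso f.
Proof.
move=> aQ mf ef; have [D [g [fg0 uf]]] := abelian_epi aQ ef.
have g0 : g = 0 by apply: mf; rewrite fg0 compm0.
have [|u [uf1 _]] := uf M (idm M); first by rewrite g0 compm0.
by exists u; split=> //; apply: ef; rewrite -compA uf1 comp1m compm1.
Qed.

Lemma deflation_in_mono (T : extri) (X Y : T -> Prop) (c : is_cotorsion_pair X Y)
    (A B : T) (f : hom A B) :
  deflation_in Y f -> heart_mono X Y f.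
Proof.
move=> df Z g [_ /cplus_op mZ] /factors_op fW; apply/factors_op.
exact: (@inflation_in_epi (opext T) Y X (cotorsion_op c) B A Z f g df mZ).
Qed.

Lemma is_zero_heart (T : extri) (X Y : T -> Prop) (c : is_cotorsion_pair X Y)
    (M : heart c) : is_zero M <-> inter X Y (sval M).
Proof.
rewrite /is_zero -heart_pi1; split=> [/heart_pi0 [W [g [h [[XW YW] e]]]]|WM].
  by split; [apply: (cot_retract c (esym e)) XW | apply: (cot_retractr c (esym e)) YW].
by apply/heart_pi0; exists (sval M), (idm _), (idm _); rewrite comp1m.
Qed.

(** * Recollements *)

Lemma ess_imI (C D : preaddCat) (F : functor C D) (U : C -> Prop) (M : C) :
  U M -> ess_im F U (F M).
Proof. by move=> UM; exists M => //; exists (idm _); apply: iso_id. Qed.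

Lemma iso_epi (C : preaddCat) (A B : C) (f : hom A B) : is_iso f -> is_epi f.
Proof.
move=> [v [_ fv]] Z g k /(congr1 (fun u => u \co v)).
by rewrite -!compA fv !compm1.
Qed.

Lemma subcat_is_zero (C : preaddCat) (U : C -> Prop) (Z : C) :
  is_subcat U -> is_zero Z -> U Z.
Proof.
move=> [ui [Z0 zZ0 UZ0] _] zZ; apply: ui UZ0.
by exists 0; apply: iso_zero_zero.
Qed.

Lemma ess_im_preimage (C D : preaddCat) (p : functor C D) (s : functor D C)
    (U : C -> Prop) :
  is_subcat U -> (forall N, isomorphic N (p (s N))) ->
  (forall M, U M -> U (s (p M))) ->
  forall N, ess_im p U N <-> U (s N).
Proof.
move=> sU iN Usp N; split=> [[M UM iNM]|UsN]; last by exists (s N).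
by apply: (subcat_iso sU) (Usp M UM); apply: fobj_iso; apply: isomorphic_sym.
Qed.

(** The composite of the left adjoints is left adjoint to zero. *)
Lemma adj_comp_zero (A B C : preaddCat) (F1 : functor C B) (G1 : functor B C)
    (F2 : functor B A) (G2 : functor A B) (h1 : adjunction F1 G1)
    (h2 : adjunction F2 G2) :
  (forall N, is_zero (G1 (G2 N))) -> forall M, is_zero (F2 (F1 M)).
Proof.
move=> GG0 M; apply: (adj_inj (h := h2)).
by rewrite [LHS](adj_zero h1 _ (GG0 _)) [RHS](adj_zero h1 _ (GG0 _)).
Qed.

Section Recollement.

Variables (A B C : extri) (R : recollement A B C).
Hypothesis wicC : WIC C.
Hypotheses (eiup : is_exact (i_up R)) (eishr : is_exact (i_shr R)).

Let iup := i_up R.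
Let ilow := i_low R.
Let ishr := i_shr R.
Let jup := j_up R.
Let jshr := j_shr R.
Let jlow := j_low R.

Lemma ilow_unit_iso N : is_iso (adj_unit (adj_ilow_ishr R) N).
Proof. exact: ff_unit_iso (ff_ilow R). Qed.

Lemma ilow_counit_iso N : is_iso (adj_counit (adj_iup_ilow R) N).
Proof. exact: ff_counit_iso (ff_ilow R). Qed.

Lemma jshr_unit_iso N : is_iso (adj_unit (adj_jshr_jup R) N).
Proof. exact: ff_unit_iso (ff_jshr R). Qed.

Lemma jlow_counit_iso N : is_iso (adj_counit (adj_jup_jlow R) N).
Proof. exact: ff_counit_iso (ff_jlow R). Qed.

Lemma jup_ilow_zero N : is_zero (jup (ilow N)).
Proof. by apply/(recol_im_ker R); apply: ess_imI. Qed.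

Lemma iup_jshr_zero N : is_zero (iup (jshr N)).
Proof. exact: (adj_comp_zero (adj_jshr_jup R) (adj_iup_ilow R) jup_ilow_zero). Qed.

Lemma ishr_jlow_zero N : is_zero (ishr (jlow N)).
Proof.
exact: (adj_comp_zero (adj_op (adj_jup_jlow R)) (adj_op (adj_ilow_ishr R))
  jup_ilow_zero).
Qed.

Lemma ishr_triangle M :
  triangle (adj_counit (adj_ilow_ishr R) M) (adj_unit (adj_jup_jlow R) M).
Proof.
have [N [v hv]] := recol_R4 R M.
exact: left_exact_seq4_triangle ilow_unit_iso (exact_triangles eishr)
  (ishr_jlow_zero _) hv.
Qed.

Lemma iup_triangle M :
  triangle (adj_counit (adj_jshr_jup R) M) (adj_unit (adj_iup_ilow R) M).
Proof.
have [N [v hv]] := recol_R5 R M.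
exact: right_exact_seq4_triangle ilow_counit_iso (exact_triangles eiup)
  (iup_jshr_zero _) hv.
Qed.

Lemma jshr_triangles : preserves_triangles jshr.
Proof.
have [cj _] := exact_jup R.
apply: (left_adjoint_triangles (h := adj_jshr_jup R) wicC jshr_unit_iso cj
  (exact_triangles (exact_jup R)) (exact_triangles eiup) iup_jshr_zero).
  move=> M iM0; apply: triangle_zero_iso (iup_triangle M) _.
  exact: fmor_zero.
move=> M N P f g [d r]; have [_ _ [t]] := rexact_jshr R.
have [x [rx e]] := reta_real t r; have [dt ct] := reta_deflP t d.
by exists (reta_obj t d), (reta_defl t d), x; split=> //; exists (reta t d).
Qed.

Lemma jlow_triangles : preserves_triangles jlow.
Proof.
have [cj _] := exact_jup R.
apply: (right_adjoint_triangles (h := adj_jup_jlow R) wicC jlow_counit_iso cj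
  (exact_triangles (exact_jup R)) (exact_triangles eishr) ishr_jlow_zero).
  move=> M iM0; apply/is_iso_op.
  apply: (@triangle_zero_iso (opext B) _ _ _ _ _ (ishr_triangle M)).
  exact: fmor_zero.
move=> M N P f g [d r]; have [_ _ [t]] := lexact_jlow R.
have [y [ry e]] := leta_real t r; have [it ct] := leta_inflP t d.
by exists (leta_obj t d), (leta_infl t d), y; split=> //; exists (leta t d).
Qed.

End Recollement.

Theorem theorem5p3 :
  forall (A B C : extri) (R : recollement A B C) (X Y : B -> Prop),
  standing A -> standing B -> standing C ->
  forall hXY : is_cotorsion_pair X Y,
  subclass (ess_im (i_low R) (ess_im (i_shr R) X)) X ->
  subclass (ess_im (i_low R) (ess_im (i_up R) X)) X ->
  subclass (ess_im (i_low R) (ess_im (i_up R) Y)) Y ->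
  subclass (ess_im (j_low R) (ess_im (j_up R) X)) X ->
  subclass (ess_im (j_low R) (ess_im (j_up R) Y)) Y ->
  subclass (ess_im (j_shr R) (ess_im (j_up R) Y)) Y ->
  is_exact (i_up R) -> is_exact (i_shr R) ->
  exists (h' : is_cotorsion_pair (ess_im (i_up R) X) (ess_im (i_shr R) Y))
         (h'' : is_cotorsion_pair (ess_im (j_up R) X) (ess_im (j_up R) Y))
         (d_ilow : descends_to_hearts (i_low R)
            (ess_im (i_up R) X) (ess_im (i_shr R) Y) X Y)
         (d_iup : descends_to_hearts (i_up R)
            X Y (ess_im (i_up R) X) (ess_im (i_shr R) Y))
         (d_ishr : descends_to_hearts (i_shr R)
            X Y (ess_im (i_up R) X) (ess_im (i_shr R) Y))
         (d_jup : descends_to_hearts (j_up R)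
            X Y (ess_im (j_up R) X) (ess_im (j_up R) Y))
         (d_jshr : descends_to_hearts (j_shr R)
            (ess_im (j_up R) X) (ess_im (j_up R) Y) X Y)
         (d_jlow : descends_to_hearts (j_low R)
            (ess_im (j_up R) X) (ess_im (j_up R) Y) X Y),
  @abelian_recollement (heart h') (heart hXY) (heart h'')
    (heart_functor h' hXY d_ilow)
    (heart_functor hXY h' d_iup) (heart_functor hXY h' d_ishr)
    (heart_functor hXY h'' d_jup)
    (heart_functor h'' hXY d_jshr) (heart_functor h'' hXY d_jlow).
Proof.
move=> A B C R X Y [wA _ _] [wB _ _] [wC _ _] hXY H1 H2 H3 H4 H5 H6 eu es.
have iiX M : X M -> X (i_low R (i_shr R M)).
  by move=> XM; apply: H1; do 2!apply: ess_imI.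
have iuX M : X M -> X (i_low R (i_up R M)).
  by move=> XM; apply: H2; do 2!apply: ess_imI.
have iuY M : Y M -> Y (i_low R (i_up R M)).
  by move=> YM; apply: H3; do 2!apply: ess_imI.
have jjX M : X M -> X (j_low R (j_up R M)).
  by move=> XM; apply: H4; do 2!apply: ess_imI.
have jjY M : Y M -> Y (j_low R (j_up R M)).
  by move=> YM; apply: H5; do 2!apply: ess_imI.
have jsY M : Y M -> Y (j_shr R (j_up R M)).
  by move=> YM; apply: H6; do 2!apply: ess_imI.
have pil := exact_triangles (exact_ilow R).
have pju := exact_triangles (exact_jup R).
have piu := exact_triangles eu; have pis := exact_triangles es.
have pjs := jshr_triangles wC eu; have pjl := jlow_triangles wC es.
have sX := cot_subX hXY; have sY := cot_subY hXY.
(* E(U, i_* i^! M) vanishes with E(i_* i^* U, M), by adjunction twice *)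
have iiY M : Y M -> Y (i_low R (i_shr R M)).
  move=> YM; apply/(cot_perpr hXY) => U XU.
  apply: (adj_ext_right (adj_iup_ilow R) piu).
  apply: (adj_ext_right (adj_ilow_ishr R) pil) => d.
  exact: (cot_CP1 hXY (iuX U XU) YM).
have XAE : forall N, ess_im (i_up R) X N <-> X (i_low R N).
  apply: ess_im_preimage sX _ iuX => N; apply: isomorphic_sym.
  by exists (adj_counit (adj_iup_ilow R) N); apply: ilow_counit_iso.
have YAE : forall N, ess_im (i_shr R) Y N <-> Y (i_low R N).
  apply: ess_im_preimage sY _ iiY => N.
  by exists (adj_unit (adj_ilow_ishr R) N); apply: ilow_unit_iso.
have jC N : isomorphic N (j_up R (j_low R N)).
  apply: isomorphic_sym.
  by exists (adj_counit (adj_jup_jlow R) N); apply: jlow_counit_iso.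
have XCE := ess_im_preimage sX jC jjX.
have YCE := ess_im_preimage sY jC jjY.
have h' : is_cotorsion_pair (ess_im (i_up R) X) (ess_im (i_shr R) Y).
  apply: (cotorsion_transfer (ps := adj_iup_ilow R) piu pil _ hXY XAE YAE).
  - exact: ilow_counit_iso.
  - by move=> M XM; apply: ess_imI.
  - by move=> M YM; apply/YAE/iuY.
have h'' : is_cotorsion_pair (ess_im (j_up R) X) (ess_im (j_up R) Y).
  apply: (cotorsion_transfer (ps := adj_jup_jlow R) pju pjl _ hXY XCE YCE).
  - exact: jlow_counit_iso.
  - by move=> M XM; apply: ess_imI.
  - by move=> M YM; apply: ess_imI.
(* E(j_! N, V) vanishes with E(N, j^* V) *)
have jsX N : ess_im (j_up R) X N -> X (j_shr R N).
  move=> XN; apply/(cot_perp hXY) => V YV.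
  apply: (adj_ext_left (adj_jshr_jup R) pju) => d.
  exact: (cot_CP1 h'' XN (ess_imI _ YV)).
have jsY' N : ess_im (j_up R) Y N -> Y (j_shr R N).
  move=> [M YM iN]; apply: (subcat_iso sY) (jsY M YM).
  exact/fobj_iso/isomorphic_sym.
have d_ilow : descends_to_hearts (i_low R)
    (ess_im (i_up R) X) (ess_im (i_shr R) Y) X Y.
  by apply: descends_preserve => // N; [move/XAE | move/YAE].
have d_iup : descends_to_hearts (i_up R)
    X Y (ess_im (i_up R) X) (ess_im (i_shr R) Y).
  apply: descends_preserve => // M h; [exact: ess_imI | exact/YAE/iuY].
have d_ishr : descends_to_hearts (i_shr R)
    X Y (ess_im (i_up R) X) (ess_im (i_shr R) Y).
  apply: descends_preserve => // M h; [exact/XAE/iiX | exact: ess_imI].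
have d_jup : descends_to_hearts (j_up R)
    X Y (ess_im (j_up R) X) (ess_im (j_up R) Y).
  by apply: descends_preserve => // M h; apply: ess_imI.
have d_jshr : descends_to_hearts (j_shr R)
    (ess_im (j_up R) X) (ess_im (j_up R) Y) X Y.
  exact: descends_preserve.
have d_jlow : descends_to_hearts (j_low R)
    (ess_im (j_up R) X) (ess_im (j_up R) Y) X Y.
  by apply: descends_preserve => // N; [move/XCE | move/YCE].
exists h', h'', d_ilow, d_iup, d_ishr, d_jup, d_jshr, d_jlow.
pose a1 := heart_adjunction (adj_iup_ilow R) hXY h' d_iup d_ilow.
pose a2 := heart_adjunction (adj_ilow_ishr R) h' hXY d_ilow d_ishr.
pose a3 := heart_adjunction (adj_jshr_jup R) h'' hXY d_jshr d_jup.
pose a4 := heart_adjunction (adj_jup_jlow R) hXY h'' d_jup d_jlow.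
have ffi : fully_faithful (heart_functor h' hXY d_ilow).
  apply: (unit_iso_ff (h := a2)) => N; apply: heart_pi_iso; exact: ilow_unit_iso.
split.
- exact: heart_abelian.
- exact: heart_abelian.
- exact: heart_abelian.
- by constructor.
- by constructor.
- by constructor.
- by constructor.
- move=> M; split=> [[N _ iMN]|].
    apply: zero_iso (fobj_iso _ (isomorphic_sym iMN)) _; apply/is_zero_heart.
    have zN := jup_ilow_zero R (sval N).
    by split; [exact: subcat_is_zero (cot_subX h'') zN |
      exact: subcat_is_zero (cot_subY h'') zN].
  move=> /is_zero_heart [/= XjM YjM].
  have aB := heart_abelian hXY wB.
  pose eta := adj_unit a1 M; pose eps := adj_counit a2 M.
  have meta : is_mono eta.
    apply: heart_pi_mono; apply: (deflation_in_mono hXY).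
    exists (j_shr R (j_up R (sval M))), (adj_counit (adj_jshr_jup R) (sval M)).
    by split; [apply: jsY' | apply: iup_triangle].
  have eeps : is_epi eps.
    apply: heart_pi_epi => Z g hZ; apply: (inflation_in_epi hXY) hZ.1.
    exists (j_low R (j_up R (sval M))), (adj_unit (adj_jup_jlow R) (sval M)).
    by split; [apply/XCE | apply: ishr_triangle].
  have eeta : is_epi eta.
    (* by naturality, eta eps is an invertible unit followed by i_* i^* eps *)
    move=> Z g k e; have ei := left_adjoint_epi a2 (left_adjoint_epi a1 eeps).
    have ci : is_iso (adj_counit a1 (heart_functor hXY h' d_ishr M)).
      by apply: heart_pi_iso; apply: ilow_counit_iso.
    apply/ei/(iso_epi (counit_iso_unitG ci)).
    by rewrite -!compA -(unit_nat a1) !compA [g \co _]e.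
  exists (heart_functor hXY h' d_iup M) => //; exists eta.
  exact: abelian_mono_epi_iso.
- exact: ffi.
- apply: (unit_iso_ff (h := a3)) => N; apply: heart_pi_iso; exact: jshr_unit_iso.
- apply: (counit_iso_ff (h := a4)) => N; apply: heart_pi_iso; exact: jlow_counit_iso.
Qed.
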